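(* Let $G$ be a group with $H_2(G)=H_3(G)=H_2(G')=0$ and suppose that one of the following conditions holds: 1) $H^2(G',\Gamma(G^{ab}))=0$; 2) $\Gamma(G^{ab})$ is a divisible group; 3) $G'/G''$ is a free abelian group. Then $$G\otimes G\cong \Gamma(G^{ab})\times G'.$$ If moreover $G$ is finitely generated and $G'$ is linear, then $G\otimes G$ is linear.
   Context: A group is called linear if, for some positive integer $n$ and some field $P$, it is isomorphic to a subgroup of $GL_n(P)$. $G'$ is the derived subgroup of $G$, $G''=(G')'$, and $G^{ab}=G/G'$. $H_k(\cdot)$ denotes group homology with coefficients in the trivial module $\mathbb{Z}$, and $H^2(G',\Gamma(G^{ab}))$ is group cohomology with coefficients in the trivial $G'$-module $\Gamma(G^{ab})$. $\Gamma$ is Whitehead's quadratic functor: for an abelian group $A$ (written additively), $\Gamma(A)$ is the abelian group generated by symbols $\gamma(a)$, $a\in A$, with relations $\gamma(-a)=\gamma(a)$ and $\gamma(a+b+c)+\gamma(a)+\gamma(b)+\gamma(c)=\gamma(a+b)+\gamma(b+c)+\gamma(c+a)$ for all $a,b,c\in A$. With $x^y=y^{-1}xy$, the non-abelian tensor square $G\otimes G$ is the group generated by the symbols $g\otimes h$ ($g,h\in G$) subject to the relations $gg_1\otimes h=(g^{g_1}\otimes h^{g_1})(g_1\otimes h)$ and $g\otimes hh_1=(g\otimes h_1)(g^{h_1}\otimes h^{h_1})$ for all $g,g_1,h,h_1\in G$. *)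

(* Defs.v *)
From HB Require Import structures.
From mathcomp Require Import all_boot all_algebra.
From mathcomp Require Import boolp functions.
From mathcomp Require Import freeg.

Set Implicit Arguments.
Unset Strict Implicit.
Unset Printing Implicit Defensive.

Import GRing.Theory.
Local Open Scope group_scope.
Local Open Scope quotient_scope.

(* Groups are mathcomp's (possibly infinite) groupType, written               *)
(* multiplicatively, and abelian groups are zmodType, written additively.     *)
(* to_multiplicative turns a zmodType into the corresponding groupType.       *)

Definition isomorphic (G H : groupType) : Prop :=
  exists f : {multiplicative G -> H}, bijective f.

Inductive generated (G : groupType) (S : G -> Prop) : G -> Prop :=
| generated_in x : S x -> generated S x
| generated1 : generated S 1
| generatedM x y : generated S x -> generated S y -> generated S (x * y)
| generatedV x : generated S x -> generated S x^-1.

Definition finitely_generated (G : groupType) : Prop :=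
  exists s : seq G, forall x : G, generated (fun y => y \in s) x.

Section Derived.
Variable G : groupType.

Definition in_derived : pred G :=
  fun x => `[< generated (fun z => exists a b : G, z = [~ a, b]) x >].

Lemma in_derived_group_closed : group_closed in_derived.
Proof.
split=> [|x y /asboolP xS /asboolP yS]; apply/asboolP; first exact: generated1.
by apply: generatedM => //; apply: generatedV.
Qed.

Definition derived := {x : G | in_derived x}.
HB.instance Definition _ := SubChoice.on derived.
HB.instance Definition _ :=
  SubChoice_isSubGroup.Build G in_derived derived in_derived_group_closed.

End Derived.

Section Abelianization.
Variable G : groupType.

Definition same_coset (x y : G) : bool := in_derived (x^-1 * y).

Lemma in_derivedM (x y : G) : in_derived x -> in_derived y -> in_derived (x * y).
Proof. by move=> /asboolP xS /asboolP yS; apply/asboolP/generatedM. Qed.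

Lemma in_derivedV (x : G) : in_derived x -> in_derived x^-1.
Proof. by move=> /asboolP xS; apply/asboolP/generatedV. Qed.

Lemma in_derivedR (x y : G) : in_derived [~ x, y].
Proof. by apply/asboolP/generated_in; exists x, y. Qed.

Lemma in_derivedJ (x y : G) : in_derived x -> in_derived (x ^ y).
Proof.
move=> xS; have -> : x ^ y = x * [~ x, y] by rewrite /commg mulgA mulgV mul1g.
by apply: in_derivedM => //; apply: in_derivedR.
Qed.

Lemma same_coset_refl : reflexive same_coset.
Proof. by move=> x; rewrite /same_coset mulVg; apply/asboolP/generated1. Qed.

Lemma same_coset_sym : symmetric same_coset.
Proof.
suff h x y : same_coset x y -> same_coset y x by move=> x y; apply/idP/idP; apply: h.
by rewrite /same_coset => /in_derivedV; rewrite invgM invgK.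
Qed.

Lemma same_coset_trans : transitive same_coset.
Proof.
move=> y x z xy yz; rewrite /same_coset.
have -> : x^-1 * z = (x^-1 * y) * (y^-1 * z) by rewrite -mulgA (mulgA y) mulgV mul1g.
exact: in_derivedM.
Qed.

Canonical same_coset_equiv :=
  EquivRel same_coset same_coset_refl same_coset_sym same_coset_trans.

Definition abelianization := {eq_quot same_coset}.
HB.instance Definition _ := Choice.on abelianization.
HB.instance Definition _ : EqQuotient _ same_coset abelianization :=
  EqQuotient.on abelianization.

Definition ab_zero : abelianization := lift_cst abelianization (1 : G).
Definition ab_opp := lift_op1 abelianization (fun x : G => x^-1).
Definition ab_add := lift_op2 abelianization (fun x y : G => x * y).

Lemma pi_ab_zero : \pi_abelianization 1 = ab_zero.
Proof. by rewrite /ab_zero -lock. Qed.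

Lemma eq_abP (x y : G) :
  reflect (x = y %[mod abelianization]) (in_derived (x^-1 * y)).
Proof. exact: (eqmodP same_coset_equiv x y). Qed.

Lemma in_derived_repr (x : G) :
  in_derived ((repr (\pi_abelianization x))^-1 * x).
Proof. by apply/eq_abP; rewrite reprK. Qed.

Lemma pi_ab_opp : {morph \pi_abelianization : x / x^-1 >-> ab_opp x}.
Proof.
move=> x; unlock ab_opp; apply/esym/eq_abP; rewrite invgK.
set x' := repr _; have -> : x' * x^-1 = ((x'^-1 * x) ^ x'^-1)^-1.
  by rewrite /conjg invgK !mulgA mulgV mul1g invgM invgK.
by apply/in_derivedV/in_derivedJ/in_derived_repr.
Qed.

Lemma pi_ab_add : {morph \pi_abelianization : x y / x * y >-> ab_add x y}.
Proof.
move=> x y; unlock ab_add; apply/esym/eq_abP.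
have := in_derived_repr y; have := in_derived_repr x.
set x' := repr _; set y' := repr _ => xS yS.
have -> : (x' * y')^-1 * (x * y) = (x'^-1 * x) ^ y' * (y'^-1 * y).
  by rewrite /conjg invgM !mulgA mulgK.
by apply: in_derivedM => //; apply: in_derivedJ.
Qed.

Lemma ab_addA : associative ab_add.
Proof.
elim/quotW=> x; elim/quotW=> y; elim/quotW=> z.
by rewrite -!pi_ab_add mulgA.
Qed.

Lemma ab_addC : commutative ab_add.
Proof.
elim/quotW=> x; elim/quotW=> y; rewrite -!pi_ab_add; apply/esym/eq_abP.
have -> : (y * x)^-1 * (x * y) = [~ x, y] by rewrite /commg /conjg invgM !mulgA.
exact: in_derivedR.
Qed.

Lemma ab_add0 : left_id ab_zero ab_add.
Proof. by elim/quotW=> x; rewrite -pi_ab_zero -pi_ab_add mul1g. Qed.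

Lemma ab_addN : left_inverse ab_zero ab_opp ab_add.
Proof.
by elim/quotW=> x; rewrite -pi_ab_opp -pi_ab_add mulVg pi_ab_zero.
Qed.

HB.instance Definition _ :=
  GRing.isZmodule.Build abelianization ab_addA ab_addC ab_add0 ab_addN.

End Abelianization.

(* A presentation is a set X of letters and a set R of relations between      *)
(* words; (x, true) stands for the letter x and (x, false) for its inverse.   *)
Section Presentation.
Variable X : choiceType.

Definition word := seq (X * bool).
Variable R : word -> word -> Prop.

Inductive pres_cong : word -> word -> Prop :=
| pres_refl u : pres_cong u u
| pres_sym u v : pres_cong u v -> pres_cong v u
| pres_trans v u w : pres_cong u v -> pres_cong v w -> pres_cong u w
| pres_cat u u' v v' :
    pres_cong u u' -> pres_cong v v' -> pres_cong (u ++ v) (u' ++ v')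
| pres_cancel x b : pres_cong [:: (x, b); (x, ~~ b)] [::]
| pres_rel u v : R u v -> pres_cong u v.

Definition pres_eq : rel word := fun u v => `[< pres_cong u v >].

Lemma pres_eq_refl : reflexive pres_eq.
Proof. by move=> u; apply/asboolP/pres_refl. Qed.

Lemma pres_eq_sym : symmetric pres_eq.
Proof. by move=> u v; apply/asboolP/asboolP => /pres_sym. Qed.

Lemma pres_eq_trans : transitive pres_eq.
Proof. by move=> v u w /asboolP uv /asboolP vw; apply/asboolP/(pres_trans uv). Qed.

Canonical pres_eq_equiv :=
  EquivRel pres_eq pres_eq_refl pres_eq_sym pres_eq_trans.

Definition presented := {eq_quot pres_eq}.
HB.instance Definition _ := Choice.on presented.
HB.instance Definition _ : EqQuotient _ pres_eq presented :=
  EqQuotient.on presented.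

Lemma eq_presP (u v : word) :
  reflect (u = v %[mod presented]) (pres_eq u v).
Proof. exact: (eqmodP pres_eq_equiv u v). Qed.

Definition word_inv (u : word) : word := rev [seq (l.1, ~~ l.2) | l <- u].

Lemma word_invK : involutive word_inv.
Proof.
move=> u; rewrite /word_inv map_rev revK -map_comp -[RHS]map_id.
by apply: eq_map => -[x b] /=; rewrite negbK.
Qed.

Lemma word_mulgV (u : word) : pres_cong (u ++ word_inv u) [::].
Proof.
elim: u => [|[x b] u IHu]; first exact: pres_refl.
rewrite /word_inv /= rev_cons -cats1.
rewrite -[_ :: _]/([:: (x, b)] ++ (u ++ (word_inv u ++ [:: (x, ~~ b)]))).
rewrite (catA u); apply: pres_trans (pres_cancel x b).
rewrite -[[:: (x, b); _]]/([:: (x, b)] ++ ([::] ++ [:: (x, ~~ b)])).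
by apply: pres_cat (pres_refl _) (pres_cat IHu (pres_refl _)).
Qed.

Lemma word_mulVg (u : word) : pres_cong (word_inv u ++ u) [::].
Proof. by rewrite -[u in X in _ ++ X]word_invK; apply: word_mulgV. Qed.

Lemma pres_inv (u v : word) :
  pres_cong u v -> pres_cong (word_inv u) (word_inv v).
Proof.
move=> uv; rewrite -[word_inv u]cats0 -[word_inv v]cat0s.
apply: (@pres_trans (word_inv u ++ (v ++ word_inv v))).
  exact: pres_cat (pres_refl _) (pres_sym (word_mulgV v)).
rewrite catA; apply: pres_cat (pres_refl _).
apply: pres_trans (word_mulVg u).
exact: pres_cat (pres_refl _) (pres_sym uv).
Qed.

Definition pres_one : presented := lift_cst presented ([::] : word).
Definition pres_invg := lift_op1 presented word_inv.
Definition pres_mul := lift_op2 presented (@cat (X * bool)).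

Lemma pres_repr (u : word) : pres_cong (repr (\pi_presented u)) u.
Proof. by apply/asboolP/eq_presP; rewrite reprK. Qed.

Lemma pi_pres_one : \pi_presented [::] = pres_one.
Proof. by rewrite /pres_one -lock. Qed.

Lemma pi_pres_invg : {morph \pi_presented : u / word_inv u >-> pres_invg u}.
Proof.
move=> u; unlock pres_invg; apply/esym/eq_presP/asboolP.
exact: pres_inv (pres_repr u).
Qed.

Lemma pi_pres_mul : {morph \pi_presented : u v / u ++ v >-> pres_mul u v}.
Proof.
move=> u v; unlock pres_mul; apply/esym/eq_presP/asboolP.
exact: pres_cat (pres_repr u) (pres_repr v).
Qed.

Lemma pres_mulA : associative pres_mul.
Proof.
elim/quotW=> u; elim/quotW=> v; elim/quotW=> w.
by rewrite -!pi_pres_mul catA.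
Qed.

Lemma pres_mul1g : left_id pres_one pres_mul.
Proof. by elim/quotW=> u; rewrite -pi_pres_one -pi_pres_mul. Qed.

Lemma pres_mulg1 : right_id pres_one pres_mul.
Proof. by elim/quotW=> u; rewrite -pi_pres_one -pi_pres_mul cats0. Qed.

Lemma pres_mulVg : left_inverse pres_one pres_invg pres_mul.
Proof.
elim/quotW=> u; rewrite -pi_pres_invg -pi_pres_mul -pi_pres_one.
by apply/eq_presP/asboolP/word_mulVg.
Qed.

Lemma pres_mulgV : right_inverse pres_one pres_invg pres_mul.
Proof.
elim/quotW=> u; rewrite -pi_pres_invg -pi_pres_mul -pi_pres_one.
by apply/eq_presP/asboolP/word_mulgV.
Qed.

HB.instance Definition _ := isGroup.Build presented
  pres_mulA pres_mul1g pres_mulg1 pres_mulVg pres_mulgV.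

End Presentation.

Section TensorSquare.
Variable G : groupType.

Definition tens (g h : G) : (G * G) * bool := ((g, h), true).

Inductive tensor_rel : word (G * G)%type -> word (G * G)%type -> Prop :=
| tensor_relMl g g1 h :
    tensor_rel [:: tens (g * g1) h] [:: tens (g ^ g1) (h ^ g1); tens g1 h]
| tensor_relMr g h h1 :
    tensor_rel [:: tens g (h * h1)] [:: tens g h1; tens (g ^ h1) (h ^ h1)].

Definition tensor_square : groupType := presented tensor_rel.

End TensorSquare.

Section GeneralLinear.
Variables (n : nat) (P : fieldType).

Definition general_linear := {A : 'M[P]_n | A \in unitmx}.
HB.instance Definition _ := SubChoice.on general_linear.

Definition gl_one : general_linear := Sub 1%:M%R (unitmx1 P n).
Definition gl_inv (A : general_linear) : general_linear :=
  Sub (invmx (val A)) (etrans (unitmx_inv (val A)) (valP A)).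
Lemma gl_mul_subproof (A B : general_linear) :
  ((val A *m val B)%R \in unitmx).
Proof. by rewrite unitmx_mul (valP A) (valP B). Qed.
Definition gl_mul (A B : general_linear) : general_linear :=
  Sub (val A *m val B)%R (gl_mul_subproof A B).

Lemma gl_mulA : associative gl_mul.
Proof. by move=> A B C; apply: val_inj; rewrite /= mulmxA. Qed.
Lemma gl_mul1g : left_id gl_one gl_mul.
Proof. by move=> A; apply: val_inj; rewrite /= mul1mx. Qed.
Lemma gl_mulg1 : right_id gl_one gl_mul.
Proof. by move=> A; apply: val_inj; rewrite /= mulmx1. Qed.
Lemma gl_mulVg : left_inverse gl_one gl_inv gl_mul.
Proof. by move=> A; apply: val_inj; rewrite /= mulVmx // (valP A). Qed.
Lemma gl_mulgV : right_inverse gl_one gl_inv gl_mul.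
Proof. by move=> A; apply: val_inj; rewrite /= mulmxV // (valP A). Qed.

HB.instance Definition _ := isGroup.Build general_linear
  gl_mulA gl_mul1g gl_mulg1 gl_mulVg gl_mulgV.

End GeneralLinear.

(* An isomorphism onto a subgroup of GL_n(P) is an injective homomorphism.    *)
Definition linear_group (G : groupType) : Prop :=
  exists (n : nat) (P : fieldType) (f : {multiplicative G -> general_linear n P}),
    (0 < n)%N /\ injective f.

Local Open Scope ring_scope.

Definition is_trivial (V : zmodType) : Prop := forall x : V, x = 0.

Definition divisible (V : zmodType) : Prop :=
  forall (n : nat) (x : V), (0 < n)%N -> exists y : V, y *+ n = x.

Definition free_abelian (V : zmodType) : Prop :=
  exists (X : choiceType) (f : {additive V -> {freeg X / int}}), bijective f.

Inductive zgenerated (V : zmodType) (S : V -> Prop) : V -> Prop :=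
| zgenerated_in x : S x -> zgenerated S x
| zgenerated0 : zgenerated S 0
| zgeneratedB x y : zgenerated S x -> zgenerated S y -> zgenerated S (x - y).

Section ZmodQuotient.
Variables (V : zmodType) (S : zmodClosed V).

Definition zquot_eq : rel V := fun x y => x - y \in S.

Lemma zquot_eq_refl : reflexive zquot_eq.
Proof. by move=> x; rewrite /zquot_eq subrr rpred0. Qed.

Lemma zquot_eq_sym : symmetric zquot_eq.
Proof. by move=> x y; rewrite /zquot_eq -opprB rpredN. Qed.

Lemma zquot_eq_trans : transitive zquot_eq.
Proof.
by move=> y x z xy yz; rewrite /zquot_eq -(subrK y x) -addrA rpredD.
Qed.

Canonical zquot_eq_equiv :=
  EquivRel zquot_eq zquot_eq_refl zquot_eq_sym zquot_eq_trans.

Definition zquot := {eq_quot zquot_eq}.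
HB.instance Definition _ := Choice.on zquot.
HB.instance Definition _ : EqQuotient _ zquot_eq zquot := EqQuotient.on zquot.

Definition zquot_zero : zquot := lift_cst zquot (0 : V).
Definition zquot_opp := lift_op1 zquot (fun x : V => - x).
Definition zquot_add := lift_op2 zquot (fun x y : V => x + y).

Lemma eq_zquotP (x y : V) : reflect (x = y %[mod zquot]) (x - y \in S).
Proof. exact: (eqmodP zquot_eq_equiv x y). Qed.

Lemma zquot_repr (x : V) : repr (\pi_zquot x) - x \in S.
Proof. by apply/eq_zquotP; rewrite reprK. Qed.

Lemma pi_zquot_zero : \pi_zquot 0 = zquot_zero.
Proof. by rewrite /zquot_zero -lock. Qed.

Lemma pi_zquot_opp : {morph \pi_zquot : x / - x >-> zquot_opp x}.
Proof.
move=> x; unlock zquot_opp; apply/esym/eq_zquotP.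
by rewrite -opprD rpredN zquot_repr.
Qed.

Lemma pi_zquot_add : {morph \pi_zquot : x y / x + y >-> zquot_add x y}.
Proof.
move=> x y; unlock zquot_add; apply/esym/eq_zquotP.
by rewrite opprD addrACA rpredD ?zquot_repr.
Qed.

Lemma zquot_addA : associative zquot_add.
Proof.
elim/quotW=> x; elim/quotW=> y; elim/quotW=> z.
by rewrite -!pi_zquot_add addrA.
Qed.

Lemma zquot_addC : commutative zquot_add.
Proof. by elim/quotW=> x; elim/quotW=> y; rewrite -!pi_zquot_add addrC. Qed.

Lemma zquot_add0 : left_id zquot_zero zquot_add.
Proof. by elim/quotW=> x; rewrite -pi_zquot_zero -pi_zquot_add add0r. Qed.

Lemma zquot_addN : left_inverse zquot_zero zquot_opp zquot_add.
Proof.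
by elim/quotW=> x; rewrite -pi_zquot_opp -pi_zquot_add addNr pi_zquot_zero.
Qed.

HB.instance Definition _ :=
  GRing.isZmodule.Build zquot zquot_addA zquot_addC zquot_add0 zquot_addN.

End ZmodQuotient.

Section Whitehead.
Variable A : zmodType.

Definition gam (a : A) : {freeg A / int} := << a >>.

Inductive gamma_relator : {freeg A / int} -> Prop :=
| gamma_relatorN a : gamma_relator (gam (- a) - gam a)
| gamma_relatorD a b c : gamma_relator
    ((gam (a + b + c) + gam a + gam b + gam c)
     - (gam (a + b) + gam (b + c) + gam (c + a))).

Definition gamma_relations : {pred {freeg A / int}} :=
  fun x => `[< zgenerated gamma_relator x >].

Lemma gamma_relations_zmod_closed : zmod_closed gamma_relations.
Proof.
split=> [|x y /asboolP xS /asboolP yS]; apply/asboolP; first exact: zgenerated0.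
exact: zgeneratedB.
Qed.

HB.instance Definition _ :=
  GRing.isZmodClosed.Build _ gamma_relations gamma_relations_zmod_closed.

Definition Gamma : zmodType := zquot gamma_relations.

End Whitehead.

(* The image is intersected with ker g, so that g \o f = 0 need not be        *)
(* assumed; when it holds this is ker g / im f.                               *)
Section Homology.
Variables (U V W : zmodType) (f : {additive U -> V}) (g : {additive V -> W}).

Definition in_ker : pred V := fun x => g x == 0.

Lemma in_ker_zmod_closed : zmod_closed in_ker.
Proof.
split=> [|x y /eqP gx /eqP gy]; apply/eqP; first by rewrite raddf0.
by rewrite raddfB gx gy subrr.
Qed.

Definition ker_of := {x : V | in_ker x}.
HB.instance Definition _ := SubChoice.on ker_of.
HB.instance Definition _ :=
  GRing.SubChoice_isSubZmodule.Build V in_ker ker_of in_ker_zmod_closed.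

Definition in_image : {pred ker_of} := fun x => `[< exists u, f u = val x >].

Lemma in_image_zmod_closed : zmod_closed in_image.
Proof.
split=> [|x y /asboolP[u fu] /asboolP[v fv]]; apply/asboolP.
  by exists 0; rewrite raddf0.
by exists (u - v); rewrite !raddfB fu fv.
Qed.

HB.instance Definition _ :=
  GRing.isZmodClosed.Build _ in_image in_image_zmod_closed.

Definition homology_at : zmodType := zquot in_image.

End Homology.

Section BarComplex.
Variable G : groupType.

(* The i-th face of (g_1, ..., g_(k+1)) in the bar construction, for          *)
(* 0 <= i <= k+1: (g_2, ..., g_(k+1)) for i = 0, (g_1, ..., g_k) for          *)
(* i = k+1, and (g_1, ..., g_i * g_(i+1), ..., g_(k+1)) otherwise.            *)
Definition bar_face k (i : nat) (t : k.+1.-tuple G) : k.-tuple G :=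
  [tuple (if (j.+1 < i)%N then nth 1%g t j
          else if j.+1 == i then (nth 1 t j * nth 1 t j.+1)%g
          else nth 1%g t j.+1) | j < k].

(* With coefficients in the trivial module int, the action on the first face  *)
(* disappears and the bar complex is free on tuples.                          *)
Definition bar_chain (k : nat) := {freeg (k.-tuple G) / int}.

Definition bar_diff k : bar_chain k.+1 -> bar_chain k :=
  fglift (fun t => \sum_(i < k.+2) (-1) ^+ i *: (<< bar_face i t >> : bar_chain k)).

Lemma bar_diff_is_zmod_morphism k : zmod_morphism (@bar_diff k).
Proof. exact: lift_is_additive. Qed.

HB.instance Definition _ k := GRing.isZmodMorphism.Build _ _ (@bar_diff k)
  (@bar_diff_is_zmod_morphism k).

Definition group_homology (k : nat) : zmodType :=
  if k is k'.+1 then homology_at (@bar_diff k'.+1) (@bar_diff k')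
  else homology_at (@bar_diff 0) (\0 : bar_chain 0 -> bar_chain 0).

Variable A : zmodType.

Definition bar_cochain (k : nat) : zmodType := (k.-tuple G -> A : Type).

Definition bar_codiff k (f : bar_cochain k) : bar_cochain k.+1 :=
  fun t => \sum_(i < k.+2) f (bar_face i t) *~ (-1) ^+ i.

Lemma bar_codiff_is_zmod_morphism k : zmod_morphism (@bar_codiff k).
Proof.
move=> f g; apply/funext => t.
transitivity (bar_codiff f t - bar_codiff g t) => //; rewrite /bar_codiff -sumrB.
by apply: eq_bigr => i _; rewrite mulrzBl.
Qed.

HB.instance Definition _ k := GRing.isZmodMorphism.Build _ _ (@bar_codiff k)
  (@bar_codiff_is_zmod_morphism k).

Definition group_cohomology (k : nat) : zmodType :=
  if k is k'.+1 then homology_at (@bar_codiff k') (@bar_codiff k'.+1)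
  else homology_at (\0 : bar_cochain 0 -> bar_cochain 0) (@bar_codiff 0).

End BarComplex.

(* Main.v *)
Require Import Defs.
From mathcomp Require Import all_boot all_algebra.
From HB Require Import structures.
From mathcomp Require Import all_order.
From mathcomp Require Import boolp functions classical_sets.
From mathcomp Require Import freeg.

Set Implicit Arguments.
Unset Strict Implicit.
Unset Printing Implicit Defensive.

Import Order.TTheory GRing.Theory Num.Theory.
Local Open Scope group_scope.
Local Open Scope quotient_scope.

(** The commutator map [tcomm : g (x) h |-> [~ g, h]] of the tensor square has
image [G'] and central kernel, and [gamma (g G') |-> g (x) g] defines a
homomorphism [Psi] from [Gamma (G^ab)] into that kernel.  Three facts make up
the isomorphism: [Psi] is injective when [H_3 G = 0] ([Psi_inj]), it is onto
the kernel when [H_2 G = 0] ([tcomm_ker_Psi]), and the resulting central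
extension of [G'] by [Gamma (G^ab)] splits ([tensor_isomorphic]).

Injectivity.  Homomorphisms out of the tensor square are crossed pairings on
[G], so one needs a crossed pairing [b] with values in a group containing
[Gamma] for which [b g g] is [gamma (g G')] up to sign.  Let [F] be the group
of bar 1-chains, and choose a biadditive [c] on [F] with values in [Gamma]
such that [c f f = gamma f].  Suppose that a group [W] maps onto [G] with
kernel [N], maps to [F] by [tau] compatibly with [G^ab], contains [Gamma] in
its centre, and satisfies [~ n, w] = c (tau n) (tau w) for [n] in [N].  Then
[~ v, w] - c (tau v) (tau w) is a crossed pairing on [W] which vanishes as soon
as one argument is in [N], since [c] is alternating against [tau N]; so it is
a pairing on [G] ([heis_tensor]).  To get [W], twist the product of the group
of 2-chains with [Gamma] by a bilinear half of [c (d p) (d q)], and extend [G]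
by the resulting group, using the 2-chains [x|y] as factor set.  This fails to
be associative by a 3-cocycle with central values whose 2-chain component is
the boundary [d [x|y|z]].  Divide these values out: [H_3 G = 0] says exactly
that the subgroup they generate meets [Gamma] trivially
([twistedq_in_inj]).

Surjectivity.  Let [E] be the quotient of the tensor square by the image of
[Psi], with its pairing [g /\ h].  Assume that [E] embeds in a group [V] over
[G] such that [~ v, w] is the pairing of the images of [v] and [w].  Then [V] is a
central extension of its image, and an element of the kernel of [E -> G] is a
product of commutators of [V] with value 1 in [G].  Computing such a product
through a section evaluates the cocycle of the extension on a 2-cycle, which
is a boundary when [H_2 G = 0]; so the product is 1 ([kap_ker]).  Such a [V]
is obtained from [E] by adjoining elements of [G] one at a time:
[v |-> v (v /\ g)] is always an automorphism, and one takes the semidirect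
product.  A boundary involves only finitely many elements of [G], so finitely
many steps suffice ([frame_cover]).

Splitting.  If [H_2 G' = 0], a 2-cocycle of [G'] amounts to a homomorphism
defined on the 1-boundaries, and it is a coboundary as soon as this
homomorphism extends to all 1-chains.  It extends when the target is divisible
([divisible_extension]), and when 1-chains modulo boundaries, that is
[G'/G''], form a free abelian group, since the boundaries are then a direct
summand.

Linearity.  If [G] is finitely generated then so is [Gamma (G^ab)], and by the
Smith normal form it embeds in a product of finitely many cyclic groups.
These have faithful representations over the rational functions over the
field of [G']: by powers of the variable, or by cyclic permutation matrices. *)

(** * Linear extension and bar chains of low degree *)
Local Open Scope ring_scope.

Section FreegExtension.
Variables (X : choiceType) (V : zmodType).
Implicit Types (f : X -> V).

(** The codomain is viewed as a module over the integers, to use the universal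
property of free modules. *)
Definition fgext f : {freeg X / int} -> V :=
  fglift (f : X -> zmodule V).

Lemma fgext_is_zmod_morphism f : zmod_morphism (fgext f).
Proof. by move=> a b; exact: (@lift_is_additive _ X (zmodule V) f a b). Qed.

HB.instance Definition _ f := GRing.isZmodMorphism.Build _ _ (fgext f)
  (@fgext_is_zmod_morphism f).

Lemma fgextU f x : fgext f << x >> = f x.
Proof. by rewrite /fgext liftU scale1r. Qed.

(** Closure under subtraction covers all integer multiples, so additive
identities need only be checked on generators. *)
Lemma freeg_gen_ind (P : {freeg X / int} -> Prop) :
  P 0 -> (forall a b, P a -> P b -> P (a - b)) -> (forall x, P << x >>) ->
  forall D, P D.
Proof.
move=> P0 PB PU D.
have PN a : P a -> P (- a) by move=> Pa; rewrite -sub0r; apply: PB.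
have PD a b : P a -> P b -> P (a + b).
  by move=> Pa Pb; rewrite -[b]opprK; apply: PB => //; apply: PN.
have PM a n : P a -> P (a *+ n).
  by move=> Pa; elim: n => [|n IH]; rewrite ?mulr0n // mulrS; apply: PD.
rewrite -[D]freeg_sumE; apply: big_ind => // x _.
rewrite -[coeff x D]intz -freegU_mulz.
by case: (coeff x D) => n; [rewrite -pmulrn; apply: PM | rewrite NegzE mulrNz -pmulrn; apply/PN/PM].
Qed.

End FreegExtension.

Section BilinearExtension.
Variables (X Y : choiceType) (V : zmodType) (f : X -> Y -> V).

Definition bilext (a : {freeg X / int}) (b : {freeg Y / int}) : V :=
  fgext (fun x => fgext (f x) b) a.

Lemma bilextU x y : bilext << x >> << y >> = f x y.
Proof. by rewrite /bilext !fgextU. Qed.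

Lemma bilextBl b : {morph bilext^~ b : a a' / a - a'}.
Proof. by move=> a a'; rewrite /bilext raddfB. Qed.

Lemma bilextBr a : {morph bilext a : b b' / b - b'}.
Proof.
move=> b b'; move: a; apply: freeg_gen_ind => [|a a' IH IH'|x].
- by rewrite /bilext !raddf0 addr0.
- rewrite !bilextBl IH IH' !opprB [LHS]addrACA [RHS]addrACA.
  by congr (_ + _); exact: addrC.
- by rewrite /bilext !fgextU raddfB.
Qed.

Lemma bilext0l b : bilext 0 b = 0.
Proof. by have := bilextBl b 0 0; rewrite /= !subrr. Qed.
Lemma bilext0r a : bilext a 0 = 0.
Proof. by have := bilextBr a 0 0; rewrite /= !subrr. Qed.
Lemma bilextNl a b : bilext (- a) b = - bilext a b.
Proof. by rewrite -[- a]sub0r bilextBl bilext0l sub0r. Qed.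
Lemma bilextNr a b : bilext a (- b) = - bilext a b.
Proof. by rewrite -[- b]sub0r bilextBr bilext0r sub0r. Qed.
Lemma bilextDl b : {morph bilext^~ b : a a' / a + a'}.
Proof. by move=> a a'; rewrite -[a' in LHS]opprK bilextBl bilextNl opprK. Qed.
Lemma bilextDr a : {morph bilext a : b b' / b + b'}.
Proof. by move=> b b'; rewrite -[b' in LHS]opprK bilextBr bilextNr opprK. Qed.

End BilinearExtension.

Section BarFormulas.
Variable G : groupType.
Local Notation C := (bar_chain G).

Definition bar1 (x : G) : {freeg (1.-tuple G) / int} := << [tuple x] >>.
Definition bar2 (x y : G) : {freeg (2.-tuple G) / int} := << [tuple x; y] >>.
Definition bar3 (x y z : G) : {freeg (3.-tuple G) / int} := << [tuple x; y; z] >>.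
Definition bar4 (x y z t : G) : {freeg (4.-tuple G) / int} := << [tuple x; y; z; t] >>.

Lemma bar_diff1U (x y : G) :
  @bar_diff G 1 (bar2 x y) = bar1 y - bar1 (x * y)%g + bar1 x.
Proof.
rewrite /bar_diff liftU scale1r !big_ord_recl big_ord0 addr0 /=.
rewrite expr0 expr1 scale1r scaleN1r exprS expr1 mulN1r opprK scale1r addrA.
by congr (_ - _ + _); congr << _ >>; apply: eq_from_tnth => i; rewrite !tnth_mktuple;
  rewrite !(tnth_nth 1%g) /= ord1.
Qed.

Lemma bar_diff2U (x y z : G) : @bar_diff G 2 (bar3 x y z) =
  bar2 y z - bar2 (x * y)%g z + bar2 x (y * z)%g - bar2 x y.
Proof.
rewrite /bar_diff liftU scale1r !big_ord_recl big_ord0 addr0 /=.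
rewrite !exprS !expr0 !mulN1r !opprK ?mulr1 !scale1r !scaleN1r !addrA.
by congr (_ - _ + _ - _); congr << _ >>; apply: eq_from_tnth => i; rewrite !tnth_mktuple;
  rewrite !(tnth_nth 1%g) /=; case: i => [[|[|]]].
Qed.

Lemma bar_diff3U (x y z t : G) : @bar_diff G 3 (bar4 x y z t) =
  bar3 y z t - bar3 (x * y)%g z t + bar3 x (y * z)%g t - bar3 x y (z * t)%g
  + bar3 x y z.
Proof.
rewrite /bar_diff liftU scale1r !big_ord_recl big_ord0 addr0 /=.
rewrite !exprS !expr0 ?mulr1 ?mulrN ?mulNr ?mulr1 !opprK !scale1r !scaleN1r !addrA.
by congr (_ - _ + _ - _ + _); congr << _ >>; apply: eq_from_tnth => i;
  rewrite !tnth_mktuple !(tnth_nth 1%g) /=; case: i => [[|[|[|]]]].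
Qed.

(** All the homological hypotheses are used in this form: cycles are
boundaries. *)
Lemma homology_exact k : is_trivial (group_homology G k.+1) ->
  forall c : C k.+1, bar_diff c = 0 -> exists d : C k.+2, bar_diff d = c.
Proof.
move=> triv c dc0.
have kc : in_ker (@bar_diff G k) c by apply/eqP.
have := triv (\pi_(homology_at (@bar_diff G k.+1) (@bar_diff G k)) (exist _ c kc)).
rewrite -[0]/(zquot_zero _) -pi_zquot_zero => /eq_zquotP; rewrite subr0.
by move=> /asboolP[d /= dE]; exists d.
Qed.

Variable A : zmodType.

Lemma bar_codiff1E (k : bar_cochain G A 1) (x y : G) :
  bar_codiff k [tuple x; y] = k [tuple y] - k [tuple (x * y)%g] + k [tuple x].
Proof.
rewrite /bar_codiff !big_ord_recl big_ord0 addr0 /=.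
rewrite !exprS !expr0 ?mulr1 ?mulrN ?mulNr ?mulr1 !opprK !mulrNz !mulr1z addrA.
by congr (_ - _ + _); congr k; apply: eq_from_tnth => i; rewrite !tnth_mktuple;
  rewrite !(tnth_nth 1%g) /= ord1.
Qed.

Lemma bar_codiff2E (k : bar_cochain G A 2) (x y z : G) :
  bar_codiff k [tuple x; y; z] =
  k [tuple y; z] - k [tuple (x * y)%g; z] + k [tuple x; (y * z)%g]
  - k [tuple x; y].
Proof.
rewrite /bar_codiff !big_ord_recl big_ord0 addr0 /=.
rewrite !exprS !expr0 ?mulr1 ?mulrN ?mulNr ?mulr1 !opprK !mulrNz !mulr1z !addrA.
by congr (_ - _ + _ - _); congr k; apply: eq_from_tnth => i; rewrite !tnth_mktuple;
  rewrite !(tnth_nth 1%g) /=; case: i => [[|[|]]].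
Qed.

Lemma cohomology_exact k : is_trivial (group_cohomology G A k.+1) ->
  forall f : bar_cochain G A k.+1, (forall t, bar_codiff f t = 0) ->
  exists h : bar_cochain G A k, forall t, bar_codiff h t = f t.
Proof.
move=> triv f df0.
have kf : in_ker (@bar_codiff G A k.+1) f by apply/eqP/funext => t; apply: df0.
have := triv (\pi_(homology_at (@bar_codiff G A k) (@bar_codiff G A k.+1)) (exist _ f kf)).
rewrite -[0]/(zquot_zero _) -pi_zquot_zero => /eq_zquotP; rewrite subr0.
by move=> /asboolP[d /= dE]; exists d => t; rewrite dE.
Qed.

End BarFormulas.

Lemma tuple1E (T : Type) (t : 1.-tuple T) : t = [tuple tnth t ord0].
Proof. by apply: eq_from_tnth => i; rewrite (ord1 i) (tnth_nth (tnth t ord0)) /=. Qed.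

Lemma tuple2P (T : Type) (t : 2.-tuple T) : exists x y, t = [tuple x; y].
Proof.
case: t => [[|x [|y [|]]] // st]; exists x, y; exact: val_inj.
Qed.
Lemma tuple3P (T : Type) (t : 3.-tuple T) : exists x y z, t = [tuple x; y; z].
Proof.
case: t => [[|x [|y [|z [|]]]] // st]; exists x, y, z; exact: val_inj.
Qed.
Lemma tuple4P (T : Type) (t : 4.-tuple T) : exists x y z w, t = [tuple x; y; z; w].
Proof.
case: t => [[|x [|y [|z [|w [|]]]]] // st]; exists x, y, z, w; exact: val_inj.
Qed.

(** * A decision procedure for abelian groups *)

(** An expression is determined by its integer coefficients on the atoms;
comparing these coefficients decides the identities that hold in every abelian
group. *)
Section ZmodReflection.

Inductive zexpr := ZVar of nat | ZZero | ZAdd of zexpr & zexpr | ZOpp of zexpr.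

Fixpoint zcoef (e : zexpr) (i : nat) : int :=
  match e with
  | ZVar j => Posz (i == j)
  | ZZero => 0
  | ZAdd e1 e2 => zcoef e1 i + zcoef e2 i
  | ZOpp e1 => - zcoef e1 i
  end.

Fixpoint zbounded (n : nat) (e : zexpr) : bool :=
  match e with
  | ZVar j => (j < n)%N
  | ZZero => true
  | ZAdd e1 e2 => zbounded n e1 && zbounded n e2
  | ZOpp e1 => zbounded n e1
  end.

Variable V : zmodType.

Fixpoint zeval (env : seq V) (e : zexpr) : V :=
  match e with
  | ZVar j => env`_j
  | ZZero => 0
  | ZAdd e1 e2 => zeval env e1 + zeval env e2
  | ZOpp e1 => - zeval env e1
  end.

Lemma zevalE env e : zbounded (size env) e ->
  zeval env e = \sum_(i < size env) env`_i *~ zcoef e i.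
Proof.
elim: e => [j|_|e1 IH1 e2 IH2|e IH] /=.
- move=> js; rewrite (bigD1 (Ordinal js)) //= eqxx mulr1z big1 ?addr0 // => i.
  by rewrite -val_eqE => /= /negPf ->; rewrite mulr0z.
- by rewrite big1 // => i _; rewrite mulr0z.
- move=> /andP[/IH1 -> /IH2 ->]; rewrite -big_split /=.
  by apply: eq_bigr => i _; rewrite mulrzDr.
- by move=> /IH ->; rewrite -sumrN; apply: eq_bigr => i _; rewrite mulrNz.
Qed.

Lemma zeval_eq (env : seq V) (e1 e2 : zexpr) :
  [&& zbounded (size env) e1, zbounded (size env) e2
    & all (fun i => zcoef e1 i == zcoef e2 i) (iota 0 (size env))] ->
  zeval env e1 = zeval env e2.
Proof.
move=> /and3P[b1 b2 /allP e12]; rewrite !zevalE //; apply: eq_bigr => i _.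
by rewrite (eqP (e12 i _)) // mem_iota /= add0n.
Qed.

End ZmodReflection.

(** Atoms are compared up to conversion, because rewriting may leave different
but convertible structure instances on both sides. *)
Ltac zm_same x y :=
  match goal with
  | _ => let _ := match goal with _ => constr_eq x y end in constr:(true)
  | _ => let _ := match goal with _ => unify x y end in constr:(true)
  | _ => constr:(false)
  end.
Ltac zm_index x env :=
  lazymatch env with
  | ?y :: ?env' =>
    lazymatch zm_same x y with
    | true => constr:(0%N)
    | false => let n := zm_index x env' in constr:(n.+1)
    end
  end.
Ltac zm_mem x env :=
  lazymatch env with
  | ?y :: ?env' =>
    lazymatch zm_same x y with
    | true => constr:(true)
    | false => zm_mem x env'
    end
  | _ => constr:(false)
  end.
Ltac zm_env t env :=
  lazymatch t with
  | (?a + ?b)%R => let env1 := zm_env a env in zm_env b env1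
  | (- ?a)%R => zm_env a env
  | 0%R => constr:(env)
  | _ => match zm_mem t env with
         | true => constr:(env)
         | false => constr:(t :: env)
         end
  end.
Ltac zm_reify t env :=
  lazymatch t with
  | (?a + ?b)%R => let ea := zm_reify a env in let eb := zm_reify b env in
                   constr:(ZAdd ea eb)
  | (- ?a)%R => let ea := zm_reify a env in constr:(ZOpp ea)
  | 0%R => constr:(ZZero)
  | _ => let n := zm_index t env in constr:(ZVar n)
  end.
Ltac zmod :=
  lazymatch goal with
  | |- @eq ?V ?a ?b =>
    let env0 := constr:(@nil V) in
    let env1 := zm_env a env0 in
    let env := zm_env b env1 in
    let ea := zm_reify a env in
    let eb := zm_reify b env in
    change (zeval env ea = zeval env eb); apply: zeval_eq; vm_compute; reflexivity
  end.

Lemma zmod_subr_eq (V : zmodType) (a b c d : V) : a = b -> c - a = d - b -> c = d.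
Proof. by move=> -> /addIr. Qed.

(** Proves [c = d] from [E : a = b] when [c - d] is [a - b] or [b - a] in
every abelian group. *)
Ltac zmod_from E :=
  first [apply: (zmod_subr_eq E); zmod | apply: (zmod_subr_eq (esym E)); zmod].

Local Close Scope ring_scope.

(** * Presented groups, centres and central quotients *)
(** Normalizes group words: products are kept associated to the left, so that
inverse letters meet and cancel. *)
Ltac gsimp := rewrite /commg /conjg ?(invgM, invgK, invg1, mul1g, mulg1, mulgA, mulgK, mulgVK, mulgV, mulVg).

(** The universal property of a group given by generators and relations. *)
Section WordEvaluation.
Variables (X : choiceType) (E : groupType) (f : X -> E).

Definition word_eval (u : word X) : E :=
  foldr (fun l e => (if l.2 then f l.1 else (f l.1)^-1) * e) 1 u.

Lemma word_eval_cat u v : word_eval (u ++ v) = word_eval u * word_eval v.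
Proof. by elim: u => [|l u IH] /=; rewrite ?mul1g // IH mulgA. Qed.

Variable R : word X -> word X -> Prop.
Hypothesis fR : forall u v, R u v -> word_eval u = word_eval v.

Lemma word_eval_cong u v : pres_cong R u v -> word_eval u = word_eval v.
Proof.
elim=> {u v} [//|//|v u w _ -> _ -> //|u u' v v' _ uE _ vE|x b|]; last exact: fR.
  by rewrite !word_eval_cat uE vE.
by case: b => /=; rewrite mulg1 ?mulgV ?mulVg.
Qed.

Definition pres_hom (t : presented R) : E := word_eval (repr t).

Lemma pres_homE u : pres_hom (\pi_(presented R) u) = word_eval u.
Proof. exact/word_eval_cong/pres_repr. Qed.

Lemma pres_hom_is_multiplicative : {morph pres_hom : s t / s * t}.
Proof.
elim/quotW=> u; elim/quotW=> v.
rewrite -[_ * _ in LHS]/(pres_mul _ _) -pi_pres_mul !pres_homE.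
exact: word_eval_cat.
Qed.

End WordEvaluation.

Arguments pres_hom {X E} f {R} t.

Section PresentedInduction.
Variables (X : choiceType) (R : word X -> word X -> Prop).

Definition letter (x : X) : presented R := \pi_(presented R) [:: (x, true)].

Lemma pi_word (u : word X) : \pi_(presented R) u = word_eval letter u.
Proof.
elim: u => [|[x b] u IH] /=; first by rewrite pi_pres_one.
rewrite -IH -cat1s pi_pres_mul; congr (_ * _); case: b => //.
by rewrite -[RHS]pi_pres_invg.
Qed.

Lemma presented_ind (P : presented R -> Prop) :
  P 1 -> (forall s t, P s -> P t -> P (s * t)) -> (forall t, P t -> P t^-1) ->
  (forall x, P (letter x)) -> forall t, P t.
Proof.
move=> P1 PM PV Px; elim/quotW=> u; rewrite pi_word.
by elim: u => [//|[x b] u IH] /=; apply: PM => //; case: b => //; apply: PV.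
Qed.

Lemma letter_rel u v : R u v -> word_eval letter u = word_eval letter v.
Proof. by move=> uv; rewrite -!pi_word; apply/eq_presP/asboolP/pres_rel. Qed.

End PresentedInduction.

Lemma pres_hom_letter (X : choiceType) (E : groupType) (f : X -> E)
  (R : word X -> word X -> Prop)
  (fR : forall u v, R u v -> word_eval f u = word_eval f v) x :
  pres_hom f (letter R x) = f x.
Proof. by rewrite pres_homE //= mulg1. Qed.

(** Cochains take values in abelian groups, so the centre is given an additive
structure; linear extension then produces homomorphisms into it. *)
Section Centre.
Variable E : groupType.

Definition in_centre : pred E := fun z => `[< forall v : E, z * v = v * z >].
Definition centre := {z : E | in_centre z}.
HB.instance Definition _ := SubChoice.on centre.

Definition to_centre (z : E) (zC : in_centre z) : centre := exist in_centre z zC.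

Lemma in_centre1 : in_centre 1.
Proof. by apply/asboolP => v; rewrite mul1g mulg1. Qed.

Lemma in_centreM z z' : in_centre z -> in_centre z' -> in_centre (z * z').
Proof.
by move=> /asboolP zC /asboolP z'C; apply/asboolP => v; rewrite -mulgA z'C !mulgA zC.
Qed.

Lemma in_centreV z : in_centre z -> in_centre z^-1.
Proof.
move=> /asboolP zC; apply/asboolP => v.
by rewrite -[v in LHS]invgK -invgM -zC invgM invgK.
Qed.

Definition centre_zero : centre := exist in_centre 1 in_centre1.
Definition centre_opp (z : centre) : centre := exist in_centre _ (in_centreV (valP z)).
Definition centre_add (z z' : centre) : centre :=
  exist in_centre _ (in_centreM (valP z) (valP z')).

Lemma centre_addA : associative centre_add.
Proof. by move=> x y z; apply: val_inj; rewrite /= mulgA. Qed.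
Lemma centre_addC : commutative centre_add.
Proof. by move=> x y; apply: val_inj => /=; case: x => x /= /asboolP->. Qed.
Lemma centre_add0 : left_id centre_zero centre_add.
Proof. by move=> x; apply: val_inj; rewrite /= mul1g. Qed.
Lemma centre_addN : left_inverse centre_zero centre_opp centre_add.
Proof. by move=> x; apply: val_inj; rewrite /= mulVg. Qed.

HB.instance Definition _ :=
  GRing.isZmodule.Build centre centre_addA centre_addC centre_add0 centre_addN.

Lemma val_centreC (z : centre) v : val z * v = v * val z.
Proof. by case: z => z /= /asboolP. Qed.
Lemma val_centreD (x y : centre) : val (x + y)%R = val x * val y.
Proof. by []. Qed.
Lemma val_centreN (x : centre) : val (- x)%R = (val x)^-1.
Proof. by []. Qed.
End Centre.

(** The quotient of a group by the image of a homomorphism into its centre,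
which is a normal subgroup. *)
Section CentralQuotient.
Variables (U : zmodType) (E : groupType) (H : {additive U -> centre E}).

Definition cquot_eq : rel E := fun x y => `[< exists u, x = y * val (H u) >].

Lemma cquot_eq_refl : reflexive cquot_eq.
Proof. by move=> x; apply/asboolP; exists 0%R; rewrite raddf0 mulg1. Qed.

Lemma cquot_eq_sym : symmetric cquot_eq.
Proof.
suff h x y : cquot_eq x y -> cquot_eq y x by move=> x y; apply/idP/idP; apply: h.
move=> /asboolP[u ->]; apply/asboolP; exists (- u)%R.
by rewrite raddfN -mulgA -val_centreD subrr mulg1.
Qed.

Lemma cquot_eq_trans : transitive cquot_eq.
Proof.
move=> y x z /asboolP[u ->] /asboolP[v ->]; apply/asboolP; exists (v + u)%R.
by rewrite raddfD val_centreD mulgA.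
Qed.

Canonical cquot_eq_equiv :=
  EquivRel cquot_eq cquot_eq_refl cquot_eq_sym cquot_eq_trans.

Definition cquot := {eq_quot cquot_eq}.
HB.instance Definition _ := Choice.on cquot.
HB.instance Definition _ : EqQuotient _ cquot_eq cquot := EqQuotient.on cquot.

Definition cquot_pi (x : E) : cquot := \pi_cquot x.

Lemma eq_cquotP (x y : E) : cquot_pi x = cquot_pi y <-> exists u, x = y * val (H u).
Proof.
split=> [xy|xy]; first by apply/asboolP; apply/(eqmodP cquot_eq_equiv x y).
by apply/(eqmodP cquot_eq_equiv x y)/asboolP.
Qed.

Lemma cquot_pi_repr x : exists u, repr (cquot_pi x) = x * val (H u).
Proof. by apply/eq_cquotP; rewrite /cquot_pi reprK. Qed.

Definition cquot_one : cquot := cquot_pi 1.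
Definition cquot_inv (x : cquot) : cquot := cquot_pi (repr x)^-1.
Definition cquot_mul (x y : cquot) : cquot := cquot_pi (repr x * repr y).

Lemma cquot_mulE x y : cquot_mul (cquot_pi x) (cquot_pi y) = cquot_pi (x * y).
Proof.
apply/eq_cquotP; have [u ->] := cquot_pi_repr x; have [v ->] := cquot_pi_repr y.
exists (u + v)%R; rewrite raddfD val_centreD !mulgA; congr (_ * _).
by rewrite -!mulgA; congr (_ * _); rewrite val_centreC.
Qed.

Lemma cquot_invE x : cquot_inv (cquot_pi x) = cquot_pi x^-1.
Proof.
apply/eq_cquotP; have [u ->] := cquot_pi_repr x; exists (- u)%R.
by rewrite invgM raddfN -val_centreN val_centreC.
Qed.

Lemma cquot_mulA : associative cquot_mul.
Proof.
by elim/quotW=> x; elim/quotW=> y; elim/quotW=> z; rewrite -!/(cquot_pi _) !cquot_mulE mulgA.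
Qed.
Lemma cquot_mul1 : left_id cquot_one cquot_mul.
Proof. by elim/quotW=> x; rewrite -!/(cquot_pi _) !cquot_mulE mul1g. Qed.
Lemma cquot_mul1r : right_id cquot_one cquot_mul.
Proof. by elim/quotW=> x; rewrite -!/(cquot_pi _) !cquot_mulE mulg1. Qed.
Lemma cquot_mulV : left_inverse cquot_one cquot_inv cquot_mul.
Proof.
by elim/quotW=> x; rewrite -!/(cquot_pi _) cquot_invE cquot_mulE mulVg.
Qed.
Lemma cquot_mulVr : right_inverse cquot_one cquot_inv cquot_mul.
Proof.
by elim/quotW=> x; rewrite -!/(cquot_pi _) cquot_invE cquot_mulE mulgV.
Qed.

HB.instance Definition _ := isGroup.Build cquot
  cquot_mulA cquot_mul1 cquot_mul1r cquot_mulV cquot_mulVr.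

Lemma cquot_piM x y : cquot_pi (x * y) = cquot_pi x * cquot_pi y.
Proof. by rewrite -cquot_mulE. Qed.
Lemma cquot_pi1 : cquot_pi 1 = 1.
Proof. by []. Qed.
Lemma cquot_piV x : cquot_pi x^-1 = (cquot_pi x)^-1.
Proof. by rewrite -cquot_invE. Qed.
Lemma cquotP (y : cquot) : exists x, y = cquot_pi x.
Proof. by elim/quotW: y => x; exists x. Qed.
Lemma cquot_kerP x : cquot_pi x = 1 <-> exists u, x = val (H u).
Proof.
rewrite -cquot_pi1 eq_cquotP; split=> -[u ->]; exists u; by rewrite ?mul1g.
Qed.

End CentralQuotient.

Lemma isomorphic_sym (G H : groupType) (f : H -> G) :
  {morph f : x y / x * y} -> bijective f -> isomorphic G H.
Proof.
move=> fM [g gK fK].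
have gM : {morph g : x y / x * y}.
  by move=> x y; apply: (can_inj gK); rewrite fM !fK.
pose m := isMultiplicative.Build G H g gM.
pose mm : {multiplicative G -> H} := HB.pack g m.
by exists mm; exists f.
Qed.

Section Morphisms.
Variables (E V : groupType) (f : E -> V) (fM : {morph f : x y / x * y}).

Lemma morph_1 : f 1 = 1.
Proof. by apply: (mulgI (f 1)); rewrite -fM !mulg1. Qed.
Lemma morph_V : {morph f : x / x^-1}.
Proof. by move=> x; apply: (mulgI (f x)); rewrite -fM !mulgV morph_1. Qed.
Lemma morph_J : {morph f : x y / x ^ y}.
Proof. by move=> x y; rewrite /conjg !fM morph_V. Qed.
Lemma morph_R : {morph f : x y / [~ x, y]}.
Proof. by move=> x y; rewrite !commgEl fM morph_V morph_J. Qed.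

End Morphisms.

(** An alias without structure, so that a product type can carry a group law
other than the componentwise one. *)
Definition group_carrier (W : choiceType) : Type := W.
HB.instance Definition _ (W : choiceType) := Choice.on (group_carrier W).

(** Left units and left inverses suffice for a group, which halves the work in
the twisted products below. *)
Section LeftGroup.
Variables (W : choiceType) (op : W -> W -> W) (u : W) (i : W -> W).
Hypotheses (opA : associative op) (op1 : left_id u op) (opV : left_inverse u i op).

Lemma left_group_inv : right_inverse u i op.
Proof.
by move=> x; rewrite -[op x _]op1 -[in LHS](opV (i x)) -opA (opA (i x) x) opV op1.
Qed.

Lemma left_group_id : right_id u op.
Proof. by move=> x; rewrite -(opV x) opA left_group_inv op1. Qed.

Definition left_group : groupType :=
  HB.pack (group_carrier W) (isGroup.Build (group_carrier W) opA op1 left_group_id opV left_group_inv).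

End LeftGroup.

(** * The tensor square as a crossed module *)
Section TensorSquareTheory.
Variable G : groupType.
Local Notation T := (tensor_square G).

Definition otimes (g h : G) : T := letter (@tensor_rel G) (g, h).

Lemma otimes_Ml g g1 h : otimes (g * g1) h = otimes (g ^ g1) (h ^ g1) * otimes g1 h.
Proof. by have /= := letter_rel (tensor_relMl g g1 h); rewrite !mulg1. Qed.

Lemma otimes_Mr g h h1 : otimes g (h * h1) = otimes g h1 * otimes (g ^ h1) (h ^ h1).
Proof. by have /= := letter_rel (tensor_relMr g h h1); rewrite !mulg1. Qed.

Lemma tensor_ind (P : T -> Prop) :
  P 1 -> (forall s t, P s -> P t -> P (s * t)) -> (forall t, P t -> P t^-1) ->
  (forall g h, P (otimes g h)) -> forall t, P t.
Proof. by move=> P1 PM PV Pz; apply: presented_ind => // -[g h]; apply: Pz. Qed.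

Section Universal.
Variables (E : groupType) (b : G -> G -> E).
Hypothesis bMl : forall g g1 h, b (g * g1) h = b (g ^ g1) (h ^ g1) * b g1 h.
Hypothesis bMr : forall g h h1, b g (h * h1) = b g h1 * b (g ^ h1) (h ^ h1).

Definition tensor_hom : T -> E := pres_hom (fun p => b p.1 p.2).

Lemma tensor_hom_rel u v : tensor_rel u v ->
  word_eval (fun p => b p.1 p.2) u = word_eval (fun p => b p.1 p.2) v.
Proof. by case=> [g g1 h|g h h1] /=; rewrite !mulg1; [apply: bMl|apply: bMr]. Qed.

Lemma tensor_homM : {morph tensor_hom : s t / s * t}.
Proof. exact: (pres_hom_is_multiplicative tensor_hom_rel). Qed.

Lemma tensor_hom_otimes g h : tensor_hom (otimes g h) = b g h.
Proof. by rewrite /tensor_hom (pres_hom_letter tensor_hom_rel). Qed.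

End Universal.

Lemma otimes1l h : otimes 1 h = 1.
Proof.
apply: (mulgI (otimes 1 h)); rewrite mulg1 -[in RHS](mulg1 1).
by rewrite otimes_Ml !conjg1.
Qed.

Lemma otimes1r g : otimes g 1 = 1.
Proof.
apply: (mulgI (otimes g 1)); rewrite mulg1 -[in RHS](mulg1 1).
by rewrite otimes_Mr !conjg1.
Qed.

Definition tcomm : T -> G := tensor_hom (fun g h => [~ g, h]).

Lemma commgMl (E : groupType) (g g1 h : E) :
  [~ g * g1, h] = [~ g ^ g1, h ^ g1] * [~ g1, h].
Proof. by gsimp. Qed.
Lemma commgMr (E : groupType) (g h h1 : E) :
  [~ g, h * h1] = [~ g, h1] * [~ g ^ h1, h ^ h1].
Proof. by gsimp. Qed.

Lemma tcommM : {morph tcomm : s t / s * t}.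
Proof. by apply: tensor_homM; [apply: commgMl|apply: commgMr]. Qed.
Lemma tcomm_otimes g h : tcomm (otimes g h) = [~ g, h].
Proof. by apply: tensor_hom_otimes; [apply: commgMl|apply: commgMr]. Qed.

Definition tact (x : G) : T -> T := tensor_hom (fun g h => otimes (g ^ x) (h ^ x)).

Lemma tact_subproofl x g g1 h :
  otimes ((g * g1) ^ x) (h ^ x) =
  otimes ((g ^ g1) ^ x) ((h ^ g1) ^ x) * otimes (g1 ^ x) (h ^ x).
Proof. by rewrite conjMg otimes_Ml -!conjJg. Qed.
Lemma tact_subproofr x g h h1 :
  otimes (g ^ x) ((h * h1) ^ x) =
  otimes (g ^ x) (h1 ^ x) * otimes ((g ^ h1) ^ x) ((h ^ h1) ^ x).
Proof. by rewrite conjMg otimes_Mr -!conjJg. Qed.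

Lemma tactM x : {morph tact x : s t / s * t}.
Proof. by apply: tensor_homM; [apply: tact_subproofl|apply: tact_subproofr]. Qed.
Lemma tact_otimes x g h : tact x (otimes g h) = otimes (g ^ x) (h ^ x).
Proof. by rewrite /tact tensor_hom_otimes; [|apply: tact_subproofl|apply: tact_subproofr]. Qed.
Lemma tact1 x : tact x 1 = 1. Proof. exact/morph_1/tactM. Qed.
Lemma tactV x t : tact x t^-1 = (tact x t)^-1. Proof. exact/morph_V/tactM. Qed.

Lemma tact_comp x y t : tact y (tact x t) = tact (x * y) t.
Proof.
move: t; apply: tensor_ind => [|s t IHs IHt|t IHt|g h]; first by rewrite !tact1.
- by rewrite !tactM IHs IHt.
- by rewrite !tactV IHt.
- by rewrite !tact_otimes !conjgM.
Qed.

Lemma tact_id t : tact 1 t = t.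
Proof.
move: t; apply: tensor_ind => [|s t IHs IHt|t IHt|g h]; first by rewrite !tact1.
- by rewrite !tactM IHs IHt.
- by rewrite !tactV IHt.
- by rewrite !tact_otimes !conjg1.
Qed.

Lemma otimes_Ml' g g1 h : otimes (g * g1) h = tact g1 (otimes g h) * otimes g1 h.
Proof. by rewrite tact_otimes otimes_Ml. Qed.
Lemma otimes_Mr' g h h1 : otimes g (h * h1) = otimes g h1 * tact h1 (otimes g h).
Proof. by rewrite tact_otimes otimes_Mr. Qed.

(** The two sides of the identity come from expanding the tensor of [g * g1]
and [h * h1] first on the left or first on the right, and cancelling the outer
factors. *)
Lemma otimes_swap g h g1 h1 :
  tact (h1 * g1) (otimes g h) * otimes g1 h1 = otimes g1 h1 * tact (g1 * h1) (otimes g h).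
Proof.
have := otimes_Ml' g g1 (h * h1); rewrite !otimes_Mr' !otimes_Ml' !tactM !tact_comp.
by rewrite !mulgA => /mulIg; rewrite -!mulgA => /mulgI ->.
Qed.

Lemma conj_otimes g h t : t ^ otimes g h = tact [~ g, h] t.
Proof.
move: t; apply: tensor_ind => [|s t IHs IHt|t IHt|g1 h1].
- by rewrite conj1g tact1.
- by rewrite conjMg IHs IHt tactM.
- by rewrite conjVg IHt tactV.
have := otimes_swap (g1 ^ (h * g)^-1) (h1 ^ (h * g)^-1) g h.
rewrite -tact_otimes !tact_comp mulVg tact_id /conjg => ->.
by rewrite mulKg; congr (tact _ _); gsimp.
Qed.

(** The Peiffer identity: together with the action of [G] it makes [tcomm] a
crossed module. *)
Lemma conj_tensor s t : t ^ s = tact (tcomm s) t.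
Proof.
move: s t; apply: tensor_ind => [|s s' IHs IHs' t|s IHs t|g h t].
- by move=> t; rewrite conjg1 (morph_1 tcommM) tact_id.
- by rewrite conjgM IHs IHs' tact_comp tcommM.
- apply: (conjg_inj s); rewrite conjgKV.
  by rewrite IHs tact_comp (morph_V tcommM) mulVg tact_id.
- by rewrite conj_otimes tcomm_otimes.
Qed.

(** Expand [g (x) (h * x ^ h) = g (x) (x * h)] in both forms, writing [g ^ h =
g * [~ g, h]]. *)
Lemma otimes_commg g h x : otimes [~ g, h] x = (otimes g h)^-1 * tact x (otimes g h).
Proof.
rewrite -[x](conjgKV h); move: (x ^ h^-1) => {}x.
have := otimes_Mr' g h (x ^ h); rewrite -conjgC otimes_Mr' (tact_otimes h).
have -> : g ^ h = g * [~ g, h] by gsimp.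
rewrite otimes_Ml' -[tact [~ g, h] _]conj_otimes {1}/conjg.
rewrite -!mulgA mulVKg => /mulgI <-.
by rewrite mulKg.
Qed.

(** Both sides are crossed homomorphisms in [t], so they agree because they
agree on generators. *)
Lemma otimes_tcomm t x : otimes (tcomm t) x = t^-1 * tact x t.
Proof.
move: t; apply: tensor_ind => [|s t IHs IHt|t IHt|g h].
- by rewrite (morph_1 tcommM) otimes1l tact1 mulg1 invg1.
- rewrite tcommM otimes_Ml' IHs IHt -conj_tensor tactM.
  by gsimp.
- have := otimes_Ml' (tcomm t)^-1 (tcomm t) x.
  rewrite mulVg otimes1l IHt -(morph_V tcommM) -conj_tensor => /esym/eqP.
  rewrite mulg_eq1 => /eqP E; apply: (conjg_inj t); rewrite E tactV.
  by gsimp.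
- by rewrite tcomm_otimes otimes_commg.
Qed.

End TensorSquareTheory.

(** * Whitehead's quadratic functor *)
Local Open Scope ring_scope.

(** The two defining relations say that [gm] is a quadratic map: it is even
and its polarization [pol] is biadditive. *)
Section GammaTheory.
Variable A : zmodType.
Local Notation Gam := (Gamma A).

Definition Gamma_pi (x : {freeg A / int}) : Gam := \pi_(Gamma A) x.

Lemma Gamma_pi_is_zmod_morphism : zmod_morphism Gamma_pi.
Proof.
by move=> x y; rewrite /Gamma_pi (pi_zquot_add _ x (- y)) (pi_zquot_opp _ y).
Qed.

HB.instance Definition _ := GRing.isZmodMorphism.Build {freeg A / int} Gam
  Gamma_pi Gamma_pi_is_zmod_morphism.

Lemma Gamma_piB : {morph Gamma_pi : x y / x - y}.
Proof. exact: raddfB. Qed.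
Lemma Gamma_piD : {morph Gamma_pi : x y / x + y}.
Proof. exact: raddfD. Qed.

Definition gm (a : A) : Gam := Gamma_pi (gam a).

Lemma pi_gamma_relator x : gamma_relator x -> Gamma_pi x = 0.
Proof.
move=> xR; rewrite -[0]/(zquot_zero _) -pi_zquot_zero; apply/eq_zquotP.
by rewrite subr0; apply/asboolP/zgenerated_in.
Qed.

Lemma gmN a : gm (- a) = gm a.
Proof.
have := pi_gamma_relator (gamma_relatorN a).
by rewrite Gamma_piB -!/(gm _) => E; zmod_from E.
Qed.

Lemma gm_cubic a b c :
  gm (a + b + c) + gm a + gm b + gm c = gm (a + b) + gm (b + c) + gm (c + a).
Proof.
have := pi_gamma_relator (gamma_relatorD a b c).
by rewrite Gamma_piB !Gamma_piD -!/(gm _) => E; zmod_from E.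
Qed.

Lemma Gamma_ind (P : Gam -> Prop) :
  P 0 -> (forall a b, P a -> P b -> P (a - b)) -> (forall x, P (gm x)) ->
  forall w, P w.
Proof.
move=> P0 PB Pg; elim/quotW => x; rewrite -/(Gamma_pi x); move: x; apply: freeg_gen_ind => [|a b Pa Pb|//].
  by rewrite raddf0.
by rewrite raddfB; apply: PB.
Qed.

Section Universal.
Variables (V : zmodType) (q : A -> V).
Hypothesis qN : forall a, q (- a) = q a.
Hypothesis q_cubic : forall a b c,
  q (a + b + c) + q a + q b + q c = q (a + b) + q (b + c) + q (c + a).

Definition Gamma_hom (w : Gam) : V := fgext q (repr w).

Lemma fgext_gamma_relations x : x \in @gamma_relations A -> fgext q x = 0.
Proof.
move=> /asboolP; elim=> {x} [x []|//|x y _ qx _ qy].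
- by move=> a; rewrite raddfB /= /gam !fgextU qN subrr.
- by move=> a b c; rewrite raddfB !raddfD /= /gam !fgextU; have E := q_cubic a b c; zmod_from E.
- exact: raddf0.
- by rewrite raddfB /= qx qy subrr.
Qed.

Lemma Gamma_homE x : Gamma_hom (Gamma_pi x) = fgext q x.
Proof.
apply/eqP; rewrite -subr_eq0 -raddfB; apply/eqP/fgext_gamma_relations.
exact: zquot_repr.
Qed.

Lemma Gamma_hom_gm a : Gamma_hom (gm a) = q a.
Proof. by rewrite Gamma_homE fgextU. Qed.

Lemma Gamma_hom_is_zmod_morphism : zmod_morphism Gamma_hom.
Proof.
elim/quotW=> x; elim/quotW=> y; rewrite -/(Gamma_pi x) -/(Gamma_pi y).
by rewrite -raddfB !Gamma_homE raddfB.
Qed.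

End Universal.

Lemma gm0 : gm 0 = 0.
Proof. by have := gm_cubic 0 0 0; rewrite !addr0 => E; zmod_from E. Qed.

Definition pol (a b : A) : Gam := gm (a + b) - gm a - gm b.

Lemma gmD a b : gm (a + b) = gm a + gm b + pol a b.
Proof. by rewrite /pol; zmod. Qed.

Lemma polC a b : pol a b = pol b a.
Proof. by rewrite /pol (_ : b + a = a + b); [zmod | exact: addrC]. Qed.

Lemma polDl c : {morph pol^~ c : a b / a + b}.
Proof.
move=> a b /=; rewrite /pol (_ : a + c = c + a); last exact: addrC.
by have E := gm_cubic a b c; zmod_from E.
Qed.

Lemma polDr c : {morph pol c : a b / a + b}.
Proof. by move=> a b; rewrite !(polC c) polDl. Qed.

Lemma pol0l a : pol 0 a = 0.
Proof. by rewrite /pol add0r gm0; zmod. Qed.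

Lemma pol0r a : pol a 0 = 0.
Proof. by rewrite polC pol0l. Qed.

Lemma polNl a b : pol (- a) b = - pol a b.
Proof. by have := polDl b a (- a); rewrite /= subrr pol0l => E; zmod_from E. Qed.

Lemma polNr a b : pol a (- b) = - pol a b.
Proof. by rewrite polC polNl polC. Qed.

Lemma pol_diag a : pol a a = gm a + gm a.
Proof.
have := gmD a (- a); rewrite subrr gm0 gmN polNr => E; zmod_from E.
Qed.

Lemma gmB a b : gm (a - b) = gm a + gm b - pol a b.
Proof. by rewrite gmD gmN polNr. Qed.

End GammaTheory.

Local Close Scope ring_scope.

(** * The map from Gamma to the kernel of the commutator map *)
Section AbelianizationMap.
Variable G : groupType.

Definition ab (x : G) : abelianization G := \pi_(abelianization G) x.

Lemma abM x y : ab (x * y) = (ab x + ab y)%R.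
Proof. exact: pi_ab_add. Qed.
Lemma ab1 : ab 1 = 0%R.
Proof. exact: pi_ab_zero. Qed.
Lemma abV x : ab x^-1 = (- ab x)%R.
Proof. exact: pi_ab_opp. Qed.
Lemma ab_eqP x y : ab x = ab y <-> in_derived (x^-1 * y).
Proof. by split=> [/eq_abP|/eq_abP]. Qed.
Lemma abP a : exists x, a = ab x.
Proof. by elim/quotW: a => x; exists x. Qed.
Lemma ab_repr x : ab (repr (ab x)) = ab x.
Proof. exact: reprK. Qed.
Lemma ab_eq0P x : ab x = 0%R <-> in_derived x.
Proof. by rewrite -ab1; split=> [/esym/ab_eqP|xG]; [|apply/esym/ab_eqP]; rewrite invg1 mul1g. Qed.

End AbelianizationMap.

Section TensorKernel.
Variable G : groupType.
Local Notation T := (tensor_square G).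
Local Notation tcomm := (@tcomm G).
Implicit Types (s t : T) (g h x : G).

(** By [otimes_tcomm], [t^-1 * tact x t] is the tensor of [1] and [x]. *)
Lemma tact_fix t x : tcomm t = 1 -> tact x t = t.
Proof.
move=> t1; have := otimes_tcomm t x; rewrite t1 otimes1l => /esym/eqP.
by rewrite mulg_eq1 => /eqP /invg_inj/esym.
Qed.

Lemma tcomm_ker_central t : tcomm t = 1 -> in_centre t.
Proof.
move=> t1; apply/asboolP => s.
by rewrite conjgC conj_tensor tact_fix.
Qed.

Lemma tcomm_ex x : in_derived x -> exists t, tcomm t = x.
Proof.
move=> /asboolP; elim=> {x} [x [a [b ->]]||x y _ [s <-] _ [t <-]|x _ [s <-]].
- by exists (otimes a b); rewrite tcomm_otimes.
- by exists 1; rewrite (morph_1 (@tcommM G)).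
- by exists (s * t); rewrite tcommM.
- by exists s^-1; rewrite (morph_V (@tcommM G)).
Qed.

Lemma in_derived_tcomm t : in_derived (tcomm t).
Proof.
move: t; apply: tensor_ind => [|s t sG tG|t tG|g h].
- by rewrite (morph_1 (@tcommM G)); apply/asboolP/generated1.
- by rewrite tcommM; apply: in_derivedM.
- by rewrite (morph_V (@tcommM G)); apply: in_derivedV.
- by rewrite tcomm_otimes; apply: in_derivedR.
Qed.

Lemma tcomm_sq g : tcomm (otimes g g) = 1.
Proof. by rewrite tcomm_otimes commgg. Qed.

(** The polarization of [g |-> g (x) g], by [otimes_sqM]. *)
Definition otimes_sym g h : T := otimes g h * otimes h g.

Lemma tcomm_sym g h : tcomm (otimes_sym g h) = 1.
Proof. by rewrite tcommM !tcomm_otimes -invgR mulVg. Qed.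

Lemma ker_mulC t s : tcomm t = 1 -> t * s = s * t.
Proof. by move=> /tcomm_ker_central/asboolP. Qed.

Lemma otimes_symC g h : otimes_sym g h = otimes_sym h g.
Proof.
apply: (mulgI (otimes g h)^-1); rewrite -(ker_mulC _ (tcomm_sym h g)) {2}/otimes_sym.
by rewrite mulgK mulKg.
Qed.

Lemma otimes_symMl g g1 h : otimes_sym (g * g1) h = otimes_sym g h * otimes_sym g1 h.
Proof.
rewrite {1}/otimes_sym otimes_Ml' otimes_Mr' -mulgA (mulgA (otimes g1 h)) -/(otimes_sym g1 h).
rewrite (ker_mulC _ (tcomm_sym g1 h)) mulgA -tactM -/(otimes_sym g h).
by rewrite tact_fix ?tcomm_sym.
Qed.

Lemma otimes_symV g h : otimes_sym g^-1 h = (otimes_sym g h)^-1.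
Proof. exact: (morph_V (fun x y => otimes_symMl x y h)). Qed.

Lemma otimes_sqM g h : otimes (g * h) (g * h) = otimes g g * otimes h h * otimes_sym g h.
Proof.
rewrite otimes_Ml' (otimes_Mr' g g h) (otimes_Mr' h g h) (tact_fix h (tcomm_sq g)) tactM.
rewrite (tact_fix h (tcomm_sq g)) -[otimes_sym g h](tact_fix h (tcomm_sym g h)) tactM.
rewrite -(ker_mulC _ (tcomm_sq g)) -!mulgA; congr (_ * _).
by rewrite !mulgA (ker_mulC _ (tcomm_sq h)).
Qed.

(** If [x = tcomm t], then [x (x) x = t^-1 * (t ^ t) = 1] by [otimes_tcomm]
and the Peiffer identity. *)
Lemma otimes_sq_derived x : in_derived x -> otimes x x = 1.
Proof.
by move=> /tcomm_ex[t <-]; rewrite otimes_tcomm -conj_tensor /conjg mulKg mulVg.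
Qed.

(** A bimultiplicative map with central values kills commutators. *)
Lemma otimes_sym_derived x h : in_derived x -> otimes_sym x h = 1.
Proof.
move=> /asboolP; elim=> {x} [x [a [b ->]]||x y _ xE _ yE|x _ xE].
- have M : {morph otimes_sym^~ h : x y / x * y} by move=> u v; apply: otimes_symMl.
  by rewrite (morph_R M); apply/eqP/commgP/(ker_mulC _ (tcomm_sym _ _)).
- by rewrite /otimes_sym otimes1l otimes1r mulg1.
- by rewrite otimes_symMl xE yE mulg1.
- by rewrite otimes_symV xE invg1.
Qed.

Lemma otimes_sq_ab g h : ab g = ab h -> otimes g g = otimes h h.
Proof.
move=> /ab_eqP; rewrite -[h in RHS](mulVKg g); move: (g^-1 * h) => x xG.
by rewrite otimes_sqM (otimes_sq_derived xG) otimes_symC (otimes_sym_derived _ xG) !mulg1.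
Qed.

Definition sq_centre (a : abelianization G) : centre T :=
  to_centre (tcomm_ker_central (tcomm_sq (repr a))).

Lemma sq_centreE g : val (sq_centre (ab g)) = otimes g g.
Proof. by apply: otimes_sq_ab; rewrite ab_repr. Qed.

Lemma otimes_sq1 : otimes 1 1 = 1 :> T. Proof. exact: otimes1l. Qed.

Lemma otimes_symgg g : otimes_sym g g = otimes g g * otimes g g.
Proof. by []. Qed.

Lemma otimes_sqV g : otimes g^-1 g^-1 = otimes g g.
Proof.
have := otimes_sqM g g^-1; rewrite mulgV otimes_sq1 (otimes_symC g) otimes_symV otimes_symgg.
by move/esym/divg1_eq/mulgI.
Qed.

Lemma sq_centreN a : sq_centre (- a)%R = sq_centre a.
Proof.
by have [g ->] := abP a; apply: val_inj; rewrite -abV !sq_centreE otimes_sqV.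
Qed.

Lemma sq_centre_cubic a b c :
  (sq_centre (a + b + c) + sq_centre a + sq_centre b + sq_centre c
  = sq_centre (a + b) + sq_centre (b + c) + sq_centre (c + a))%R.
Proof.
have [x ->] := abP a; have [y ->] := abP b; have [z ->] := abP c.
rewrite -!abM.
pose sc g h : centre T := to_centre (tcomm_ker_central (tcomm_sym g h)).
have scM g h : sq_centre (ab (g * h)) = (sq_centre (ab g) + sq_centre (ab h) + sc g h)%R.
  by apply: val_inj; rewrite sq_centreE otimes_sqM -!sq_centreE.
have scMl g h k : sc (g * h) k = (sc g k + sc h k)%R by apply: val_inj; apply: otimes_symMl.
have scC g h : sc g h = sc h g by apply: val_inj; apply: otimes_symC.
by rewrite !scM scMl (scC z x); zmod.
Qed.

(** Whitehead's map, sending [gamma (g G')] to [g (x) g]. *)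
Definition Psi : Gamma (abelianization G) -> centre T := Gamma_hom sq_centre.

HB.instance Definition _ := GRing.isZmodMorphism.Build _ _ Psi
  (Gamma_hom_is_zmod_morphism sq_centreN sq_centre_cubic).

Lemma Psi_gm g : val (Psi (gm (ab g))) = otimes g g.
Proof. by rewrite /Psi (Gamma_hom_gm sq_centreN sq_centre_cubic) sq_centreE. Qed.

Lemma tcomm_Psi w : tcomm (val (Psi w)) = 1.
Proof.
move: w; apply: Gamma_ind => [|v w vE wE|a].
- by rewrite raddf0; apply: (morph_1 (@tcommM G)).
- by rewrite raddfB tcommM (morph_V (@tcommM G)) vE wE invg1 mulg1.
- by have [g ->] := abP a; rewrite Psi_gm tcomm_sq.
Qed.

End TensorKernel.

(** * A crossed pairing from a central extension with an alternating form *)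
(** Data for an extension of [G] by [N]: the form [c] measures commutators in
[N] through [d], and [F] acts on [N] by [hact], extending the action of [N] on
itself by conjugation ([heis_hact_conj]). The action is a variable specified
by [hactE] so that rewriting does not see the product it stands for. *)
Section HeisenbergExtension.
Variables (G N : groupType) (F Gam : zmodType).
Variables (e : G -> F) (c : F -> F -> Gam) (d : N -> F) (i : Gam -> N).
Variable r : G -> G -> N.
Hypothesis cDl : forall b, {morph c^~ b : a a' / (a + a')%R}.
Hypothesis cDr : forall a, {morph c a : b b' / (b + b')%R}.
Hypothesis dM : forall n m, d (n * m) = (d n + d m)%R.
Hypothesis iD : forall a b, i (a + b)%R = i a * i b.
Hypothesis iC : forall a n, i a * n = n * i a.
Hypothesis di : forall a, d (i a) = 0%R.
Hypothesis N_comm : forall n m, n * m = m * n * i (c (d n) (d m)).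
Hypothesis c_alt : forall n f, (c (d n) f + c f (d n) = 0)%R.
Hypothesis dr : forall x y, d (r x y) = (e x + e y - e (x * y)%g)%R.

Variable hact : N -> F -> N.
Hypothesis hactE : forall n f, hact n f = n * i (c (d n) f).

Lemma heis_c0l b : c 0%R b = 0%R.
Proof. by apply: (addrI (c 0%R b)); rewrite -[LHS]cDl !addr0. Qed.
Lemma heis_c0r b : c b 0%R = 0%R.
Proof. by apply: (addrI (c b 0%R)); rewrite -[LHS]cDr !addr0. Qed.
Lemma heis_cNl a b : c (- a)%R b = (- c a b)%R.
Proof. by have := cDl b a (- a)%R; rewrite /= subrr heis_c0l => E; zmod_from E. Qed.
Lemma heis_i0 : i 0%R = 1.
Proof. by apply: (mulgI (i 0%R)); rewrite -iD addr0 mulg1. Qed.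
Lemma heis_iN a : i (- a)%R = (i a)^-1.
Proof. by apply: (mulgI (i a)); rewrite -iD subrr heis_i0 mulgV. Qed.
Lemma heis_d1 : d 1 = 0%R.
Proof. by rewrite -heis_i0 di. Qed.
Lemma heis_dV n : d n^-1 = (- d n)%R.
Proof. by have := dM n n^-1; rewrite mulgV heis_d1 => E; zmod_from E. Qed.

Lemma heis_d_hact n f : d (hact n f) = d n.
Proof. by rewrite hactE dM di addr0. Qed.

Lemma heis_hactM n m f : hact (n * m) f = hact n f * hact m f.
Proof. by rewrite !hactE dM cDl iD !mulgA; congr (_ * _); rewrite -!mulgA iC. Qed.

Lemma heis_hactD n f g : hact n (f + g)%R = hact (hact n f) g.
Proof. by rewrite [RHS]hactE heis_d_hact !hactE cDr iD mulgA. Qed.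

Lemma heis_hact0 n : hact n 0%R = n.
Proof. by rewrite hactE heis_c0r heis_i0 mulg1. Qed.

Lemma heis_hactV n f : hact n^-1 f = (hact n f)^-1.
Proof. by rewrite !hactE invgM heis_dV heis_cNl heis_iN -!heis_iN iC. Qed.

Lemma heis_hact_conj n m : m * hact n (d m) = n * m.
Proof. by rewrite hactE mulgA -N_comm. Qed.

Lemma heis_hactNK n f : hact (hact n (- f)%R) f = n.
Proof. by rewrite -heis_hactD addNr heis_hact0. Qed.

Lemma heis_hact_i a f : hact (i a) f = i a.
Proof. by rewrite hactE di heis_c0l heis_i0 mulg1. Qed.

Section Defect.
Variable h : G -> G -> G -> N.
Hypothesis hC : forall x y z n, h x y z * n = n * h x y z.
Hypothesis dh : forall x y z, d (h x y z) = 0%R.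
Hypothesis hE : forall x y z,
  r (x * y) z * hact (r x y) (e z) = h x y z * (r x (y * z) * r y z).

(** The defect [h] of the factor set [r] is a 3-cocycle: both sides compare
the same two bracketings of a product of four elements. *)
Lemma defect_cocycle x y z w :
  h x y z * h x (y * z) w * h y z w = h (x * y) z w * h x y (z * w).
Proof.
have hact_h x' y' z' f : hact (h x' y' z') f = h x' y' z'.
  by rewrite hactE dh heis_c0l heis_i0 mulg1.
pose R := r x (y * (z * w)) * (r y (z * w) * r z w).
have hCA x' y' z' a b : a * (h x' y' z' * b) = h x' y' z' * (a * b).
  by rewrite mulgA -hC mulgA.
apply: (mulIg R); transitivity
  (r (x * y * z) w * (hact (r (x * y) z) (e w) * hact (r x y) (e z + e w)%R)).
  rewrite heis_hactD -heis_hactM hE heis_hactM hact_h heis_hactM hCA -(mulgA x) (mulgA (r _ w)) hE.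
  by rewrite -(mulgA (h x (y * z) w)) -(mulgA (r _ (_ * w))) hE (hCA y z w) !mulgA.
have -> : (e z + e w = e (z * w)%g + d (r z w))%R by rewrite dr; zmod.
rewrite mulgA hE heis_hactD -!(mulgA (h _ _ _)) -(mulgA (r _ _)) heis_hact_conj.
by rewrite (mulgA (r _ _)) hE -!mulgA.
Qed.

End Defect.

Hypothesis r_cocycle : forall x y z,
  r (x * y) z * hact (r x y) (e z) = r x (y * z) * r y z.

Definition heis_carrier := (G * N)%type.
HB.instance Definition _ := Choice.on heis_carrier.

Definition heis_mul (v w : heis_carrier) : heis_carrier :=
  (v.1 * w.1, r v.1 w.1 * hact v.2 (e w.1) * w.2).
(** The factor set is not normalized, hence the correction by [r 1 1]. *)
Definition heis_one : heis_carrier := (1, (r 1 1)^-1).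
Definition heis_inv (v : heis_carrier) : heis_carrier :=
  (v.1^-1, hact ((r v.1^-1 v.1)^-1 * (v.2 * r 1 1)^-1) (- e v.1)%R).

Lemma heis_mulA : associative heis_mul.
Proof.
move=> [x n] [y m] [z l]; rewrite /heis_mul /=; congr (_, _); first exact: mulgA.
rewrite !heis_hactM -(heis_hactD n) !mulgA r_cocycle -!mulgA; congr (_ * _).
rewrite !mulgA; congr (_ * _ * _).
have -> : (e y + e z = e (y * z)%g + d (r y z))%R by rewrite dr; zmod.
by rewrite heis_hactD heis_hact_conj.
Qed.

Lemma heis_r1 y : hact (r 1 1) (e y) = r 1 y.
Proof. by apply: (mulgI (r 1 y)); have := r_cocycle 1 1 y; rewrite !mul1g. Qed.

Lemma heis_mul1 : left_id heis_one heis_mul.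
Proof.
move=> [y m]; rewrite /heis_mul /heis_one /=; congr (_, _); first exact: mul1g.
by rewrite heis_hactV heis_r1 mulgV mul1g.
Qed.

Lemma heis_mulV : left_inverse heis_one heis_inv heis_mul.
Proof.
move=> [x n]; rewrite /heis_mul /heis_inv /heis_one /=; congr (_, _).
  exact: mulVg.
by rewrite heis_hactNK mulVKg invgM mulgVK.
Qed.

Definition heis : groupType := left_group heis_mulA heis_mul1 heis_mulV.

Lemma heisME (v w : heis) : v * w = heis_mul v w :> heis_carrier.
Proof. by []. Qed.

Definition heis_tau (v : heis) : F := (e v.1 + d v.2)%R.

Lemma heis_tauM v w : heis_tau (v * w) = (heis_tau v + heis_tau w)%R.
Proof. by rewrite heisME /heis_tau /= !dM heis_d_hact dr; zmod. Qed.

Definition heis_proj (v : heis) : G := v.1.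
Lemma heis_projM : {morph heis_proj : v w / v * w}.
Proof. by []. Qed.

Definition heis_in (a : Gam) : heis := ((1, (r 1 1)^-1 * i a) : heis_carrier).

Lemma heis_e1 : e 1 = d (r 1 1).
Proof. by rewrite dr mulg1; zmod. Qed.

Lemma heis_r1r y : r y 1 = r 1 1.
Proof.
have := r_cocycle y 1 1; rewrite !mulg1 => /mulgI ry.
by have := heis_hact_conj (r y 1) (r 1 1); rewrite -heis_e1 ry => /mulIg.
Qed.

Lemma heis_inl a (v : heis) : heis_in a * v = ((v.1, v.2 * i a) : heis_carrier).
Proof.
case: v => y l; rewrite heisME /heis_mul /= mul1g; congr (_, _).
by rewrite heis_hactM heis_hactV heis_r1 heis_hact_i mulVKg iC.
Qed.

Lemma heis_inr a (v : heis) : v * heis_in a = ((v.1, v.2 * i a) : heis_carrier).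
Proof.
case: v => y l; rewrite heisME /heis_mul /= mulg1; congr (_, _).
by rewrite heis_r1r heis_e1 heis_hact_conj !mulgA mulgK.
Qed.

Lemma heis_inC a v : heis_in a * v = v * heis_in a.
Proof. by rewrite heis_inl heis_inr. Qed.

Lemma heis_inD a b : heis_in (a + b)%R = heis_in a * heis_in b.
Proof. by rewrite heis_inr /= -mulgA -iD. Qed.

Lemma heis_in_inj : injective i -> injective heis_in.
Proof. by move=> i_inj a b [] /mulgI/i_inj. Qed.

(** An element of the kernel of [heis_proj] acts through [hact], and its [tau]
is a value of [d]. *)
Lemma heis_comm_ker (k v : heis) : heis_proj k = 1 ->
  k * v = v * k * heis_in (c (heis_tau k) (heis_tau v)).
Proof.
case: k v => x m [y l] /= x1; rewrite /heis_proj /= in x1; rewrite {x}x1.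
rewrite heis_inr !heisME /heis_mul /heis_tau /= mul1g mulg1; congr (_, _).
rewrite heis_r1r heis_e1 heis_hact_conj -(mulgA l) -[r 1 y]heis_r1 -heis_hactM -dM.
move: (r 1 1 * m) => n; rewrite -[LHS]heis_hact_conj -heis_hactD.
by rewrite hactE mulgA.
Qed.

(** The correction makes the commutator pairing vanish when one argument lies
over [1], so that it only depends on the images in [G]. *)
Definition heis_pair (v w : heis) : heis :=
  [~ v, w] * heis_in (- c (heis_tau v) (heis_tau w))%R.

Lemma heis_tau1 : heis_tau 1 = 0%R.
Proof. by apply: (addrI (heis_tau 1)); rewrite -heis_tauM mulg1 addr0. Qed.
Lemma heis_tauV v : heis_tau v^-1 = (- heis_tau v)%R.
Proof. by have := heis_tauM v v^-1; rewrite mulgV heis_tau1 => E; zmod_from E. Qed.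
Lemma heis_tauJ v w : heis_tau (v ^ w) = heis_tau v.
Proof. by rewrite /conjg !heis_tauM heis_tauV; zmod. Qed.

Lemma heis_inACA p q a b :
  p * heis_in a * (q * heis_in b) = p * q * heis_in (a + b)%R.
Proof. by rewrite heis_inD !mulgA -(mulgA p) heis_inC mulgA. Qed.

Lemma heis_pairMl v v' w :
  heis_pair (v * v') w = heis_pair (v ^ v') (w ^ v') * heis_pair v' w.
Proof.
rewrite /heis_pair commgMl !heis_tauJ heis_tauM cDl opprD.
exact: (esym (heis_inACA _ _ _ _)).
Qed.

Lemma heis_pairMr v w w' :
  heis_pair v (w * w') = heis_pair v w' * heis_pair (v ^ w') (w ^ w').
Proof.
rewrite /heis_pair commgMr !heis_tauJ heis_tauM cDr opprD addrC.
exact: (esym (heis_inACA _ _ _ _)).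
Qed.

Lemma heis_in0 : heis_in 0%R = 1.
Proof. by apply: (mulgI (heis_in 0%R)); rewrite -heis_inD addr0 mulg1. Qed.
Lemma heis_inN a : heis_in (- a)%R = (heis_in a)^-1.
Proof. by apply: (mulgI (heis_in a)); rewrite -heis_inD subrr heis_in0 mulgV. Qed.

Lemma heis_pair_kerl k v : heis_proj k = 1 -> heis_pair k v = 1.
Proof.
move=> k1; rewrite /heis_pair heis_inN; apply/eqP; rewrite divg_eq1; apply/eqP.
by apply: (mulgI (v * k)); rewrite -commgC heis_comm_ker.
Qed.

Lemma heis_tau_ker k : heis_proj k = 1 -> exists n, heis_tau k = d n.
Proof.
case: k => x m; rewrite /heis_proj /= => ->; exists (r 1 1 * m).
by rewrite /heis_tau /= heis_e1 dM.
Qed.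

Lemma heis_pair_kerr v k : heis_proj k = 1 -> heis_pair v k = 1.
Proof.
move=> k1; have := heis_pair_kerl v k1; rewrite /heis_pair !heis_inN.
have [n kn] := heis_tau_ker k1.
have -> : c (heis_tau v) (heis_tau k) = (- c (heis_tau k) (heis_tau v))%R.
  by rewrite kn; have E := c_alt n (heis_tau v); zmod_from E.
by rewrite heis_inN => /divg1_eq E; rewrite -invgR E invgK mulVg.
Qed.

Lemma heis_pair_proj v v' w w' : heis_proj v = heis_proj v' ->
  heis_proj w = heis_proj w' -> heis_pair v w = heis_pair v' w'.
Proof.
move=> vv' ww'; have -> : v = (v / v') * v' by rewrite mulgVK.
have -> : w = (w / w') * w' by rewrite mulgVK.
rewrite heis_pairMl heis_pair_kerl ?mul1g; last first.
  by rewrite (morph_J heis_projM) heis_projM (morph_V heis_projM) vv' mulgV conj1g.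
rewrite heis_pairMr [X in _ * X]heis_pair_kerr ?mulg1 //.
by rewrite (morph_J heis_projM) heis_projM (morph_V heis_projM) ww' mulgV conj1g.
Qed.

Definition heis_lift (x : G) : heis := ((x, 1) : heis_carrier).

Definition heis_bracket (x y : G) : heis := heis_pair (heis_lift x) (heis_lift y).

Lemma heis_bracketMl x x' y :
  heis_bracket (x * x') y = heis_bracket (x ^ x') (y ^ x') * heis_bracket x' y.
Proof.
rewrite /heis_bracket (@heis_pair_proj _ (heis_lift x * heis_lift x') _ (heis_lift y)) //.
rewrite heis_pairMl; congr (_ * _); apply: heis_pair_proj;
  exact: (morph_J heis_projM).
Qed.

Lemma heis_bracketMr x y y' :
  heis_bracket x (y * y') = heis_bracket x y' * heis_bracket (x ^ y') (y ^ y').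
Proof.
rewrite /heis_bracket (@heis_pair_proj _ (heis_lift x) _ (heis_lift y * heis_lift y')) //.
rewrite heis_pairMr; congr (_ * _); apply: heis_pair_proj;
  exact: (morph_J heis_projM).
Qed.

Lemma heis_bracket_diag x : heis_bracket x x = heis_in (- c (e x) (e x))%R.
Proof. by rewrite /heis_bracket /heis_pair commgg mul1g /heis_tau /= heis_d1 addr0. Qed.

(** The pairing on [G] sends a diagonal element [x, x] into [Gam], because
commutators [~ v, v] vanish. *)
Lemma heis_tensor : exists (W : groupType) (f : tensor_square G -> W) (j : Gam -> W),
  [/\ {morph f : s t / s * t}, forall a b, j (a + b)%R = j a * j b,
      injective i -> injective j & forall x, f (otimes x x) = j (- c (e x) (e x))%R].
Proof.
exists heis, (tensor_hom heis_bracket), heis_in; split.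
- exact: tensor_homM heis_bracketMl heis_bracketMr.
- exact: heis_inD.
- exact: heis_in_inj.
- move=> x; rewrite (tensor_hom_otimes heis_bracketMl heis_bracketMr).
  exact: heis_bracket_diag.
Qed.

End HeisenbergExtension.

(** * Injectivity of Psi when the third homology vanishes *)
Section Tournament.
Variable X : choiceType.

(** An orientation of the pairs of distinct elements, read off from the choice
function: it selects one of the two orders of each pair, so that bilinear
forms can be defined by triangular matrices without ordering the basis. *)
Definition prefers (x y : X) : bool := choose (pred2 x y) x == x.

Lemma prefers_asym x y : x != y -> prefers y x = ~~ prefers x y.
Proof.
move=> xy; rewrite /prefers.
have -> : choose (pred2 y x) y = choose (pred2 x y) x.
  rewrite (@eq_choose _ _ (pred2 x y)); last by move=> z; rewrite /= orbC.
  by apply: choose_id; rewrite /= eqxx ?orbT.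
have : pred2 x y (choose (pred2 x y) x) by apply: chooseP; rewrite /= eqxx.
case/orP => /eqP ->; first by rewrite eqxx (negPf xy).
by rewrite eqxx eq_sym xy.
Qed.

End Tournament.

Section GammaInjective.
Variable G : groupType.
Local Notation A := (abelianization G).
Local Notation Gam := (Gamma A).
Local Notation F := {freeg (1.-tuple G) / int}.
Local Notation P := {freeg (2.-tuple G) / int}.
Local Notation C3 := {freeg (3.-tuple G) / int}.
Local Open Scope ring_scope.

Definition bd2 (p : P) : F := @bar_diff G 1 p.
Definition bd3 (p : C3) : P := @bar_diff G 2 p.

HB.instance Definition _ := GRing.Additive.copy bd2 (@bar_diff G 1).
HB.instance Definition _ := GRing.Additive.copy bd3 (@bar_diff G 2).

Lemma bd2B : {morph bd2 : x y / x - y}. Proof. exact: raddfB. Qed.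
Lemma bd2D : {morph bd2 : x y / x + y}. Proof. exact: raddfD. Qed.
Lemma bd2_0 : bd2 0 = 0. Proof. exact: raddf0. Qed.

Lemma bd2E x y : bd2 (bar2 x y) = bar1 y - bar1 (x * y)%g + bar1 x.
Proof. exact: bar_diff1U. Qed.
Lemma bd3E x y z :
  bd3 (bar3 x y z) = bar2 y z - bar2 (x * y)%g z + bar2 x (y * z)%g - bar2 x y.
Proof. exact: bar_diff2U. Qed.

Lemma bar1_ind (Q : F -> Prop) : Q 0 -> (forall a b, Q a -> Q b -> Q (a - b)) ->
  (forall x, Q (bar1 x)) -> forall f, Q f.
Proof.
move=> Q0 QB Q1; apply: freeg_gen_ind => // t; rewrite (tuple1E t); exact: Q1.
Qed.

Lemma bar2_ind (Q : P -> Prop) : Q 0 -> (forall a b, Q a -> Q b -> Q (a - b)) ->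
  (forall x y, Q (bar2 x y)) -> forall f, Q f.
Proof.
by move=> Q0 QB Q1; apply: freeg_gen_ind => // t; have [x [y ->]] := tuple2P t; apply: Q1.
Qed.

Definition ab_ext : F -> A := fgext (fun t : 1.-tuple G => ab (tnth t ord0)).
HB.instance Definition _ :=
  GRing.Additive.copy ab_ext (fgext (fun t : 1.-tuple G => ab (tnth t ord0))).

Lemma ab_ext1 x : ab_ext (bar1 x) = ab x.
Proof. by rewrite /ab_ext fgextU. Qed.

Lemma ab_ext_bd2 p : ab_ext (bd2 p) = 0.
Proof.
move: p; apply: bar2_ind => [|a b pa pb|x y]; first by rewrite !raddf0.
  by rewrite !raddfB /= pa pb subrr.
by rewrite bd2E raddfD raddfB /= !ab_ext1 abM; zmod.
Qed.

(** An upper triangular Gram matrix for [gm] on the basis of 1-chains: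
diagonal entries are values of [gm], off-diagonal ones values of [pol], each
pair counted once. *)
Definition gram_base (s t : 1.-tuple G) : Gam :=
  if s == t then gm (ab (tnth s ord0))
  else if prefers s t then pol (ab (tnth s ord0)) (ab (tnth t ord0)) else 0.

Definition gram : F -> F -> Gam := bilext gram_base.

Lemma gramBl g : {morph gram^~ g : x y / x - y}. Proof. exact: bilextBl. Qed.
Lemma gramBr g : {morph gram g : x y / x - y}. Proof. exact: bilextBr. Qed.

Lemma gram_sym f g : gram f g + gram g f = pol (ab_ext f) (ab_ext g).
Proof.
move: f; apply: freeg_gen_ind => [|a b fa fb|s].
- by rewrite /gram bilext0l bilext0r raddf0 pol0l addr0.
- rewrite /gram bilextBl bilextBr raddfB polDl polNl -fa -fb /gram; zmod.
move: g; apply: freeg_gen_ind => [|a b fa fb|t].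
- by rewrite /gram bilext0l bilext0r raddf0 pol0r addr0.
- by rewrite /gram bilextBl bilextBr raddfB polDr polNr -fa -fb /gram; zmod.
rewrite /gram !bilextU /gram_base /ab_ext !fgextU.
have [<-|st] := eqVneq s t; first by rewrite ?eqxx pol_diag.
rewrite ?(eq_sym t) ?(negPf st) (prefers_asym st).
by case: (prefers s t); rewrite /= ?addr0 // add0r polC.
Qed.

Lemma gram_diag f : gram f f = gm (ab_ext f).
Proof.
move: f; apply: freeg_gen_ind => [|a b fa fb|s].
- by rewrite /gram bilext0l raddf0 gm0.
- rewrite raddfB gmB -fa -fb -gram_sym /gram bilextBl !bilextBr; zmod.
by rewrite /gram bilextU /gram_base eqxx /ab_ext fgextU.
Qed.

(** The class of a boundary in the abelianization is zero, so its polarization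
with anything vanishes. *)
Lemma gram_alt p f : gram (bd2 p) f + gram f (bd2 p) = 0.
Proof. by rewrite gram_sym ab_ext_bd2 pol0l. Qed.

(** The form [gram (bd2 p) (bd2 q)] is alternating; keeping one of each pair
of opposite entries writes it as a bilinear form minus its transpose. *)
Definition half_base (s t : 2.-tuple G) : Gam :=
  if (s != t) && prefers s t then gram (bd2 << s >>) (bd2 << t >>) else 0.
Definition half : P -> P -> Gam := bilext half_base.

Lemma halfBl g : {morph half^~ g : x y / x - y}. Proof. exact: bilextBl. Qed.
Lemma halfBr g : {morph half g : x y / x - y}. Proof. exact: bilextBr. Qed.

Lemma half_alt p q : half p q = half q p + gram (bd2 p) (bd2 q).
Proof.
move: p; apply: freeg_gen_ind => [|a b pa pb|s].
- by rewrite /half bd2_0 /gram !(bilext0l, bilext0r) addr0.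
- rewrite halfBl halfBr bd2B gramBl pa pb; zmod.
move: q; apply: freeg_gen_ind => [|a b pa pb|t].
- by rewrite /half bd2_0 /gram !(bilext0l, bilext0r) addr0.
- by rewrite halfBl halfBr bd2B gramBr pa pb; zmod.
rewrite /half !bilextU /half_base.
have [<-|st] := eqVneq s t; first by rewrite gram_diag ab_ext_bd2 gm0 add0r.
rewrite (prefers_asym st) /=.
case: (prefers s t) => /=; first by rewrite add0r.
by rewrite addrC gram_alt.
Qed.

(** The group of 2-chains extended by [Gam] so that commutators are measured
by [gram] on boundaries, see [twisted_comm]. *)
Definition twisted_mul (n m : (P * Gam)%type) : (P * Gam)%type :=
  (n.1 + m.1, n.2 + m.2 + half n.1 m.1).
Definition twisted_inv (n : (P * Gam)%type) : (P * Gam)%type :=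
  (- n.1, - n.2 + half n.1 n.1).

Lemma twisted_mulA : associative twisted_mul.
Proof.
move=> [p a] [q b] [s c]; rewrite /twisted_mul /=; congr (_, _); first exact: addrA.
by rewrite /half bilextDl bilextDr; zmod.
Qed.
Lemma twisted_mul1 : left_id (0, 0) twisted_mul.
Proof.
by move=> [p a]; rewrite /twisted_mul /=; congr (_, _); rewrite ?/half ?bilext0l ?addr0 add0r.
Qed.
Lemma twisted_mulV : left_inverse (0, 0) twisted_inv twisted_mul.
Proof.
move=> [p a]; rewrite /twisted_mul /=; congr (_, _); first exact: addNr.
by rewrite /half bilextNl; zmod.
Qed.

Definition twisted : groupType := left_group twisted_mulA twisted_mul1 twisted_mulV.

Definition twisted_d (n : twisted) : F := bd2 n.1.
Definition twisted_in (w : Gam) : twisted := ((0, w) : (P * Gam)%type).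
(** The 2-chain [x|y] as a factor set: its boundary compares [x * y] with the
sum of [x] and [y]. *)
Definition twisted_r (x y : G) : twisted := ((bar2 x y, 0) : (P * Gam)%type).
Definition twisted_act (n : twisted) (f : F) : twisted := (n * twisted_in (gram (twisted_d n) f))%g.

Lemma twistedME (n m : twisted) : (n * m)%g = twisted_mul n m. Proof. by []. Qed.

Lemma twisted_dM n m : twisted_d (n * m)%g = twisted_d n + twisted_d m.
Proof. exact: bd2D. Qed.
Lemma twisted_inD a b : twisted_in (a + b) = (twisted_in a * twisted_in b)%g.
Proof. by rewrite twistedME /twisted_mul /= addr0 /half bilext0l addr0. Qed.
Lemma twisted_inC a n : (twisted_in a * n = n * twisted_in a)%g.
Proof. by rewrite !twistedME /twisted_mul /= addr0 add0r /half bilext0l bilext0r (addrC a). Qed.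
Lemma twisted_d_in a : twisted_d (twisted_in a) = 0.
Proof. exact: bd2_0. Qed.
Lemma twisted_comm n m : (n * m = m * n * twisted_in (gram (twisted_d n) (twisted_d m)))%g.
Proof.
case: n m => [p a] [q b].
rewrite !twistedME /twisted_mul /twisted_d /=; congr (_, _); first by rewrite addr0 addrC.
by rewrite half_alt [half _ 0]bilext0r; zmod.
Qed.
Lemma twisted_d_r x y : twisted_d (twisted_r x y) = bar1 x + bar1 y - bar1 (x * y)%g.
Proof. by rewrite /twisted_d bd2E; zmod. Qed.
Lemma twisted_actE n f : twisted_act n f = (n * twisted_in (gram (twisted_d n) f))%g.
Proof. by []. Qed.
Lemma gramDl g : {morph gram^~ g : x y / x + y}. Proof. exact: bilextDl. Qed.
Lemma gramDr g : {morph gram g : x y / x + y}. Proof. exact: bilextDr. Qed.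
Lemma twisted_d1 : twisted_d 1%g = 0. Proof. exact: bd2_0. Qed.
Lemma twisted_dV n : twisted_d n^-1%g = - twisted_d n.
Proof. by have := twisted_dM n n^-1; rewrite mulgV twisted_d1 => E; zmod_from E. Qed.
Lemma twisted_d_act n f : twisted_d (twisted_act n f) = twisted_d n.
Proof. by rewrite twisted_dM twisted_d_in addr0. Qed.

Lemma twisted_ker_central n : twisted_d n = 0 -> in_centre n.
Proof.
move=> n0; apply/asboolP => m; rewrite twisted_comm n0 [gram 0 _]bilext0l.
by rewrite (_ : twisted_in 0 = 1%g) ?mulg1.
Qed.

(** The failure of [twisted_r] to be a cocycle for the product of [G] and
[twisted]. *)
Definition defect (x y z : G) : twisted :=
  (twisted_r (x * y) z * twisted_act (twisted_r x y) (bar1 z) * (twisted_r x (y * z) * twisted_r y z)^-1)%g.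

Lemma twisted_d_defect x y z : twisted_d (defect x y z) = 0.
Proof.
rewrite /defect twisted_dM twisted_dV (twisted_dM _ (twisted_act _ _)) twisted_d_act.
rewrite (twisted_dM (twisted_r x _) (twisted_r y z)) !twisted_d_r.
by rewrite (_ : x * (y * z) = x * y * z)%g; [zmod | exact: mulgA].
Qed.

Lemma defect_fst x y z : (defect x y z).1 = - bd3 (bar3 x y z).
Proof.
rewrite bd3E /defect /= addr0.
by rewrite /bar2; zmod.
Qed.

Definition defect_centre (t : 3.-tuple G) : centre twisted :=
  to_centre (twisted_ker_central
    (twisted_d_defect (tnth t ord0) (tnth t (inord 1)) (tnth t (inord 2)))).

Lemma defect_centreE x y z : val (defect_centre [tuple x; y; z]) = defect x y z.
Proof. by rewrite /= !(tnth_nth 1%g) /= !inordK. Qed.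

Definition defect_ext : C3 -> centre twisted := fgext defect_centre.
HB.instance Definition _ := GRing.Additive.copy defect_ext (fgext defect_centre).

Lemma defect_extB : {morph defect_ext : x y / x - y}. Proof. exact: raddfB. Qed.
Lemma defect_extD : {morph defect_ext : x y / x + y}. Proof. exact: raddfD. Qed.

Lemma defect_ext3 x y z : val (defect_ext (bar3 x y z)) = defect x y z.
Proof. by rewrite /defect_ext fgextU defect_centreE. Qed.

(** Up to sign the 2-chain component of the defect is the boundary, so a
combination of defects lying in [Gam] comes from a 3-cycle. *)
Lemma defect_ext_fst p : (val (defect_ext p)).1 = - bd3 p.
Proof.
move: p; apply: freeg_gen_ind => [|a b pa pb|t].
- by rewrite !raddf0.
- by rewrite !raddfB /= pa pb.
- have [x [y [z ->]]] := tuple3P t.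
  by rewrite -/(bar3 x y z) defect_ext3 defect_fst.
Qed.

(** The cocycle identity of the defect; hence the defects of 3-boundaries
vanish. *)
Lemma defect_ext_cycle (q : bar_chain G 4) : defect_ext (@bar_diff G 3 q) = 0.
Proof.
move: q; apply: freeg_gen_ind => [|a b pa pb|t]; first by rewrite !raddf0.
  by rewrite !raddfB /= pa pb subrr.
have [x [y [z [w ->]]]] := tuple4P t.
rewrite -/(bar4 x y z w) bar_diff3U.
rewrite !(defect_extB, defect_extD).
suff E : defect_ext (bar3 x y z) + defect_ext (bar3 x (y * z)%g w)
         + defect_ext (bar3 y z w)
       = defect_ext (bar3 (x * y)%g z w) + defect_ext (bar3 x y (z * w)%g).
  by zmod_from E.
apply: val_inj; rewrite !val_centreD !defect_ext3.
apply: (defect_cocycle gramDl gramDr twisted_dM twisted_inD twisted_inC twisted_d_in twisted_comm twisted_d_r twisted_actE).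
- by move=> x0 x1 x2 n; have /asboolP := twisted_ker_central (twisted_d_defect x0 x1 x2); apply.
- exact: twisted_d_defect.
- by move=> *; rewrite /defect mulgVK.
Qed.

Section Quotient.
Hypothesis H3G : is_trivial (group_homology G 3).

Definition twistedq : groupType := cquot defect_ext.
Definition twistedq_d (n : twistedq) : F := twisted_d (repr n).
Definition twistedq_in (w : Gam) : twistedq := cquot_pi defect_ext (twisted_in w).
Definition twistedq_r (x y : G) : twistedq := cquot_pi defect_ext (twisted_r x y).
Definition twistedq_act (n : twistedq) (f : F) : twistedq := (n * twistedq_in (gram (twistedq_d n) f))%g.

Lemma twisted_d_defect_ext u : twisted_d (val (defect_ext u)) = 0.
Proof.
rewrite /twisted_d defect_ext_fst raddfN /=.
move: u; apply: freeg_gen_ind => [|a b pa pb|t]; first by rewrite !raddf0.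
  by rewrite !raddfB /= pa pb subrr.
have [x [y [z ->]]] := tuple3P t.
by have := twisted_d_defect x y z; rewrite /twisted_d defect_fst raddfN.
Qed.

Lemma twistedq_dE n : twistedq_d (cquot_pi defect_ext n) = twisted_d n.
Proof.
by rewrite /twistedq_d; have [u ->] := cquot_pi_repr defect_ext n; rewrite twisted_dM twisted_d_defect_ext addr0.
Qed.

Lemma twistedq_dM n m : twistedq_d (n * m)%g = twistedq_d n + twistedq_d m.
Proof.
have [n' ->] := cquotP n; have [m' ->] := cquotP m.
by rewrite -cquot_piM !twistedq_dE twisted_dM.
Qed.

Lemma twistedq_comm n m : (n * m = m * n * twistedq_in (gram (twistedq_d n) (twistedq_d m)))%g.
Proof.
have [n' ->] := cquotP n; have [m' ->] := cquotP m.
by rewrite /twistedq_in !twistedq_dE -(cquot_piM _ n') -(cquot_piM _ m') -(cquot_piM _ (m' * n')%g) -twisted_comm.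
Qed.

Lemma twistedq_actE n f : twistedq_act (cquot_pi defect_ext n) f = cquot_pi defect_ext (twisted_act n f).
Proof. by rewrite /twistedq_act /twistedq_in twistedq_dE -cquot_piM. Qed.

Lemma twistedq_cocycle x y z :
  (twistedq_r (x * y) z * twistedq_act (twistedq_r x y) (bar1 z) = twistedq_r x (y * z) * twistedq_r y z)%g.
Proof.
rewrite twistedq_actE -[LHS]cquot_piM -[RHS]cquot_piM; apply/eq_cquotP; exists (bar3 x y z).
rewrite defect_ext3; have /asboolP <- := twisted_ker_central (twisted_d_defect x y z).
by rewrite /defect mulgVK.
Qed.

(** If a combination [u] of defects lies in [Gam], then [u] is a 3-cycle,
hence a boundary, and its defect vanishes. *)
Lemma twistedq_in_inj : injective twistedq_in.
Proof.
move=> a b ab; have /cquot_kerP[u] : cquot_pi defect_ext (twisted_in (a - b)) = 1%g.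
  rewrite twisted_inD cquot_piM -/(twistedq_in a) ab -cquot_piM -twisted_inD subrr; exact: cquot_pi1.
move=> E; have u0 : bd3 u = 0.
  by apply: oppr_inj; rewrite -defect_ext_fst -E oppr0.
have [v vE] := homology_exact H3G u0.
have u1 : defect_ext u = 0 by rewrite -[u]vE; exact: defect_ext_cycle.
have {E} : twisted_in (a - b) = val (defect_ext u) by []. rewrite u1.
by case=> E; zmod_from E.
Qed.

(** The crossed pairing of [heis_tensor] gives a map out of the tensor square
whose composite with [Psi] is, up to sign, an embedding of [Gam]. *)
Theorem Psi_inj : injective (@Psi G).
Proof.
have c_alt n f : gram (twistedq_d n) f + gram f (twistedq_d n) = 0 by exact: gram_alt.
have inD a b : twistedq_in (a + b) = (twistedq_in a * twistedq_in b)%g.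
  by rewrite /twistedq_in twisted_inD cquot_piM.
have inC a n : (twistedq_in a * n = n * twistedq_in a)%g.
  by have [m ->] := cquotP n; rewrite /twistedq_in -(cquot_piM _ m) -(cquot_piM _ _ m) twisted_inC.
have d_in a : twistedq_d (twistedq_in a) = 0 by rewrite /twistedq_in twistedq_dE twisted_d_in.
have d_r x y : twistedq_d (twistedq_r x y) = bar1 x + bar1 y - bar1 (x * y)%g.
  by rewrite /twistedq_r twistedq_dE twisted_d_r.
have actE n f : twistedq_act n f = (n * twistedq_in (gram (twistedq_d n) f))%g by [].
have [W [f [j [fM jD j_inj fE]]]] :=
  heis_tensor gramDl gramDr twistedq_dM inD inC d_in twistedq_comm c_alt d_r actE twistedq_cocycle.
have jN a : j (- a) = (j a)^-1%g.
  have j0 : j 0 = 1%g by apply: (mulgI (j 0)); rewrite -jD addr0 mulg1.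
  by apply: (mulgI (j a)); rewrite -jD subrr mulgV.
have fPsi w : f (val (Psi w)) = j (- w).
  move: w; apply: Gamma_ind => [|v w vE wE|a].
  - by rewrite raddf0 oppr0 (morph_1 fM); have := jN 0; rewrite oppr0 => /eqP;
      rewrite -mulg_eq1 -jD addr0 => /eqP.
  - rewrite raddfB val_centreD val_centreN fM (morph_V fM) vE wE -jN -jD.
    by congr j; zmod.
  - have [x ->] := abP a; rewrite Psi_gm fE gram_diag ab_ext1 //.
move=> v w vw; apply: oppr_inj; apply: (j_inj twistedq_in_inj).
by rewrite -!fPsi vw.
Qed.

End Quotient.

End GammaInjective.

(** * Words, 2-chains and central extensions *)
Section WordChains.
Variable G : groupType.
Local Notation C1 := {freeg (1.-tuple G) / int}.
Local Notation C2 := {freeg (2.-tuple G) / int}.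
Local Notation C3 := {freeg (3.-tuple G) / int}.

Definition word_value (u : word G) : G := word_eval id u.

(** In a central extension with section [s], multiplying out a word letter by
letter collects one cocycle value per letter; this chain records them
([word_eval_section]). *)
Fixpoint word_chain (u : word G) : C2 :=
  match u with
  | [::] => 0%R
  | (x, true) :: u' => (word_chain u' + bar2 x (word_value u'))%R
  | (x, false) :: u' => (word_chain u' - bar2 x (x^-1 * word_value u')%g)%R
  end.

Fixpoint word_exp (u : word G) : C1 :=
  match u with
  | [::] => 0%R
  | (x, b) :: u' => (word_exp u' + if b then bar1 x else - bar1 x)%R
  end.

(** In particular the chain of a product of commutators with value 1 is a
cycle. *)
Lemma bar_diff_word_chain u :
  @bar_diff G 1 (word_chain u) = (word_exp u + bar1 1%g - bar1 (word_value u))%R.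
Proof.
elim: u => [|[x [|]] u IH] /=; first by rewrite raddf0 add0r subrr.
- by rewrite raddfD /= IH bar_diff1U -/(word_value u); zmod.
rewrite raddfB /= IH bar_diff1U -/(word_value u).
have -> : x * (x^-1 * word_value u) = word_value u := mulVKg _ _.
by zmod.
Qed.

Definition commutator_letter (l : (G * G) * bool) : word G :=
  let g := l.1.1 in let h := l.1.2 in
  if l.2 then [:: (g, false); (h, false); (g, true); (h, true)]
  else [:: (h, false); (g, false); (h, true); (g, true)].

Definition commutator_word (u : word (G * G)%type) : word G :=
  flatten (map commutator_letter u).

Lemma word_exp_cat u v : word_exp (u ++ v) = (word_exp u + word_exp v)%R.
Proof.
by elim: u => [|[x b] u IH] /=; rewrite ?add0r // IH addrAC.
Qed.

Lemma word_exp_commutator u : word_exp (commutator_word u) = 0%R.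
Proof.
rewrite /commutator_word; elim: u => [//|[[g h] b] u IH] /=.
by rewrite word_exp_cat IH; case: b => /=; zmod.
Qed.

Lemma word_eval_commutator (V : groupType) (f : G -> V) u :
  word_eval f (commutator_word u) = word_eval (fun q => [~ f q.1, f q.2]) u.
Proof.
rewrite /commutator_word; elim: u => [//|[[g h] b] u IH] /=.
rewrite word_eval_cat IH; congr (_ * _).
by case: b; rewrite ?invgR /= /commg /conjg mulg1.
Qed.

(** The map [p] need not be onto; the section and its cocycle are only
meaningful on the elements that [p] attains, and cocycle values outside the
centre are replaced by zero. *)
Section CentralExtension.
Variables (V : groupType) (p : V -> G).
Hypothesis pM : {morph p : v w / v * w}.
Hypothesis p_central : forall v, p v = 1 -> in_centre v.

Definition attained (x : G) : Prop := exists v, p v = x.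

Definition section_of (x : G) : V :=
  if pselect (attained x) is left H then projT1 (cid H) else 1.

Lemma section_ofK x : attained x -> p (section_of x) = x.
Proof. by rewrite /section_of; case: pselect => // H _; case: (cid H). Qed.

Lemma attainedM x y : attained x -> attained y -> attained (x * y).
Proof. by move=> [v <-] [w <-]; exists (v * w). Qed.
Lemma attainedV x : attained x -> attained x^-1.
Proof. by move=> [v <-]; exists v^-1; rewrite (morph_V pM). Qed.
Local Notation s := section_of.

Definition section_cocycle (t : 2.-tuple G) : centre V :=
  let x := tnth t ord0 in let y := tnth t ord_max in
  insubd (0%R : centre V) (s x * s y * (s (x * y))^-1).

Lemma section_cocycleE x y : attained x -> attained y ->
  s x * s y = val (section_cocycle [tuple x; y]) * s (x * y).
Proof.
move=> xV yV; have -> : section_cocycle [tuple x; y]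
    = insubd (0%R : centre V) (s x * s y * (s (x * y))^-1).
  by rewrite /section_cocycle !(tnth_nth 1).
rewrite insubdK ?mulgVK //; apply: p_central; rewrite !pM (morph_V pM) !section_ofK ?mulgV //.
exact: attainedM.
Qed.

Definition section_ext : C2 -> centre V := fgext section_cocycle.
HB.instance Definition _ := GRing.Additive.copy section_ext (fgext section_cocycle).

Lemma section_ext2 t : section_ext << t >> = section_cocycle t.
Proof. exact: fgextU. Qed.
Lemma section_extD : {morph section_ext : a b / (a + b)%R}. Proof. exact: raddfD. Qed.
Lemma section_extB : {morph section_ext : a b / (a - b)%R}. Proof. exact: raddfB. Qed.

Lemma section_ext_boundary x y z : attained x -> attained y -> attained z ->
  section_ext (@bar_diff G 2 (bar3 x y z)) = 0%R.
Proof.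
move=> xV yV zV; rewrite bar_diff2U.
rewrite !(section_extB, section_extD) !section_ext2.
suff E : (section_cocycle [tuple y; z] + section_cocycle [tuple x; (y * z)%g]
  = section_cocycle [tuple x; y] + section_cocycle [tuple (x * y)%g; z])%R.
  by zmod_from E.
apply: val_inj; rewrite !val_centreD; apply: (mulIg (s (x * y * z))).
have xyV := attainedM xV yV; have yzV := attainedM yV zV.
transitivity (s x * s y * s z).
  rewrite -[x * y * z]mulgA -mulgA -[RHS]mulgA -section_cocycleE // (section_cocycleE yV zV).
  by rewrite !mulgA val_centreC.
by rewrite section_cocycleE // -mulgA section_cocycleE // mulgA.
Qed.

Lemma word_attained u : (forall l, l \in u -> attained l.1) -> attained (word_value u).
Proof.
elim: u => [_|[x b] u IH uV] /=; first by exists 1; rewrite (morph_1 pM).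
have xV : attained x by apply: (uV (x, b)); rewrite mem_head.
have {}uV : attained (word_value u).
  by apply: IH => l lu; apply: uV; rewrite inE lu orbT.
by rewrite /word_value /=; case: b; apply: attainedM => //; apply: attainedV.
Qed.

Lemma word_eval_section u : (forall l, l \in u -> attained l.1) ->
  word_eval s u * s 1 = val (section_ext (word_chain u)) * s (word_value u).
Proof.
elim: u => [_|[x b] u IH uV] /=; first by rewrite raddf0.
have xV : attained x by apply: (uV (x, b)); rewrite mem_head.
have {}uV : forall l, l \in u -> attained l.1.
  by move=> l lu; apply: uV; rewrite inE lu orbT.
have vV := word_attained uV.
rewrite -mulgA (IH uV) /word_value /= -!/(word_value u).
move: (word_value u) vV => v vV.
case: b.
  rewrite section_extD section_ext2 val_centreD -[RHS]mulgA -section_cocycleE //.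
  by rewrite !mulgA val_centreC.
have xvV : attained (x^-1 * v) by apply: attainedM => //; exact: (attainedV xV).
have E := section_cocycleE xV xvV; rewrite mulVKg in E.
rewrite section_extB section_ext2 val_centreD val_centreN -[RHS]mulgA [LHS]mulgA.
rewrite -val_centreC -[LHS]mulgA; congr (_ * _).
apply: (mulgI (s x)); rewrite mulVKg mulgA -val_centreN -val_centreC -mulgA E.
by rewrite val_centreN mulKg.
Qed.

End CentralExtension.

End WordChains.

Lemma additive_eq0_dom (X : choiceType) (W : zmodType)
  (f : {additive {freeg X / int} -> W}) (c : {freeg X / int}) :
  (forall x, x \in dom c -> f << x >> = 0%R) -> f c = 0%R.
Proof.
move=> f0; rewrite -[c]freeg_sumE raddf_sum big_seq big1 // => x xc.
by rewrite -[coeff x c]intz -freegU_mulz raddfMz f0 // mul0rz.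
Qed.

(** * Embedding an exterior pairing into commutators *)
(** The exterior pairing of [E] over [G]: a crossed pairing [lam] that
vanishes on the diagonal, whose composite with [kap] is the commutator, and
which is compatible with the commutators of [E]. *)
Section Frames.
Variables (G E : groupType) (kap : E -> G) (lam : G -> G -> E).
Hypothesis kapM : {morph kap : s t / s * t}.
Hypothesis lamMl : forall g g1 h, lam (g * g1) h = lam (g ^ g1) (h ^ g1) * lam g1 h.
Hypothesis lamMr : forall g h h1, lam g (h * h1) = lam g h1 * lam (g ^ h1) (h ^ h1).
Hypothesis lam_diag : forall g, lam g g = 1.
Hypothesis lam_skew : forall g h, lam h g = (lam g h)^-1.
Hypothesis kap_lam : forall g h, kap (lam g h) = [~ g, h].
Hypothesis lamJ : forall g h x, lam g h * lam [~ g, h] x = lam (g ^ x) (h ^ x).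
Hypothesis lam_kap : forall s t, lam (kap s) (kap t) = [~ s, t].

Lemma lam1l h : lam 1 h = 1.
Proof.
apply: (mulgI (lam 1 h)); rewrite mulg1 -[in RHS](mulg1 1).
by rewrite lamMl !conjg1.
Qed.

Lemma lam1r h : lam h 1 = 1.
Proof. by rewrite lam_skew lam1l invg1. Qed.

(** [E] embeds in a group over [G] whose commutators are given by the pairing.
*)
Definition frame (V : groupType) (p : V -> G) (i : E -> V) : Prop :=
  [/\ {morph p : v w / v * w}, {morph i : s t / s * t}, injective i,
      forall t, p (i t) = kap t & forall v w, [~ v, w] = i (lam (p v) (p w))].

Lemma frame_base : frame kap id.
Proof. by split=> // s t; rewrite lam_kap. Qed.

(** Adjoining to a frame [V] an abelian group [K] over [G] on which the
pairing is trivial: each [k] acts on [V] by [v |-> v (v /\ k)], which is the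
conjugation that the commutators of a frame prescribe, and one takes the
semidirect product. As for [hact], the action is a variable specified by an
equation. *)
Section Step.
Variables (V : groupType) (p : V -> G) (i : E -> V).
Hypothesis Vframe : frame p i.
Variables (K : groupType) (eps : K -> G).
Hypothesis epsM : {morph eps : k l / k * l}.
Hypothesis K_comm : forall k l : K, k * l = l * k.
Hypothesis lam_eps : forall k l : K, lam (eps k) (eps l) = 1.
Variable vact : V -> K -> V.
Hypothesis vactE : forall v k, vact v k = v * i (lam (p v) (eps k)).

Let pM : {morph p : v w / v * w}. Proof. by case: Vframe. Qed.
Let iM : {morph i : s t / s * t}. Proof. by case: Vframe. Qed.
Let i_inj : injective i. Proof. by case: Vframe. Qed.
Let pi t : p (i t) = kap t. Proof. by case: Vframe. Qed.
Let VR v w : [~ v, w] = i (lam (p v) (p w)). Proof. by case: Vframe. Qed.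

Lemma frame_conj g h w : i (lam g h) ^ w = i (lam (g ^ p w) (h ^ p w)).
Proof.
have -> : i (lam g h) ^ w = i (lam g h) * [~ i (lam g h), w].
  by rewrite commgEl mulVKg.
by rewrite VR pi kap_lam -iM lamJ.
Qed.

Lemma step_p_vact v k : p (vact v k) = p v ^ eps k.
Proof. by rewrite vactE pM pi kap_lam commgEl mulVKg. Qed.

(** Conjugating [i (lam g h)] by [w] applies the action of [p w] to both
arguments, so this is the left expansion rule of [lam]. *)
Lemma step_vactM v w k : vact (v * w) k = vact v k * vact w k.
Proof.
by rewrite !vactE pM lamMl iM -frame_conj; gsimp.
Qed.

(** The right expansion rule of [lam], with [eps k] and [eps l] commuting. *)
Lemma step_vact_mul v k l : vact v (k * l) = vact (vact v k) l.
Proof.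
rewrite [RHS]vactE step_p_vact !vactE K_comm epsM lamMr iM mulgA.
by rewrite (_ : eps l ^ eps k = eps l) // /conjg -epsM K_comm epsM mulKg.
Qed.

Lemma step_vact1 v : vact v 1 = v.
Proof. by rewrite vactE (morph_1 epsM) lam1r (morph_1 iM) mulg1. Qed.

Lemma step_vact1l k : vact 1 k = 1.
Proof. by rewrite vactE (morph_1 pM) lam1l (morph_1 iM) mulg1. Qed.

Definition step_mul (v w : (K * V)%type) : (K * V)%type :=
  (v.1 * w.1, vact v.2 w.1 * w.2).
Definition step_inv (v : (K * V)%type) : (K * V)%type :=
  (v.1^-1, vact v.2^-1 v.1^-1).

Lemma step_mulA : associative step_mul.
Proof.
move=> [k v] [l w] [m x]; rewrite /step_mul /=; congr (_, _); first exact: mulgA.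
by rewrite step_vactM step_vact_mul mulgA.
Qed.
Lemma step_mul1 : left_id (1, 1) step_mul.
Proof. by move=> [k v]; rewrite /step_mul /= step_vact1l !mul1g. Qed.
Lemma step_mulV : left_inverse (1, 1) step_inv step_mul.
Proof. by move=> [k v]; rewrite /step_mul /= -step_vact_mul !mulVg step_vact1 mulVg. Qed.

Definition step : groupType := left_group step_mulA step_mul1 step_mulV.

Lemma stepME (v w : step) : v * w = step_mul v w. Proof. by []. Qed.

Definition step_p (v : step) : G := eps v.1 * p v.2.
Definition step_j (v : V) : step := ((1, v) : (K * V)%type).
Definition step_s (k : K) : step := ((k, 1) : (K * V)%type).
Definition step_i (t : E) : step := step_j (i t).

Lemma step_pM : {morph step_p : v w / v * w}.
Proof.
move=> v w; by rewrite /step_p /= epsM pM step_p_vact; gsimp.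
Qed.
Lemma step_jM : {morph step_j : v w / v * w}.
Proof. by move=> v w; rewrite stepME /step_mul /= mulg1 step_vact1. Qed.
Lemma step_sM : {morph step_s : v w / v * w}.
Proof. by move=> v w; rewrite stepME /step_mul /= mulg1 step_vact1l. Qed.
Lemma step_iM : {morph step_i : v w / v * w}.
Proof. by move=> v w; rewrite /step_i iM step_jM. Qed.
Lemma step_i_inj : injective step_i.
Proof. by move=> s t [] /i_inj. Qed.
Lemma step_p_j v : step_p (step_j v) = p v.
Proof. by rewrite /step_p /= (morph_1 epsM) mul1g. Qed.
Lemma step_p_s k : step_p (step_s k) = eps k.
Proof. by rewrite /step_p /= (morph_1 pM) mulg1. Qed.

Lemma step_split (v : step) : v = step_s v.1 * step_j v.2.
Proof. by case: v => k v; rewrite stepME /step_mul /= mulg1 step_vact1 mul1g. Qed.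

Lemma step_jJs v k : step_j v ^ step_s k = step_j (vact v k).
Proof.
apply: (mulgI (step_s k)); rewrite -conjgC !stepME /step_mul /=.
by rewrite mulg1 mul1g mulg1 step_vact1 mul1g.
Qed.

Lemma step_conj g h w : step_i (lam g h) ^ w = step_i (lam (g ^ step_p w) (h ^ step_p w)).
Proof.
rewrite {1}(step_split w) conjgM /step_i step_jJs -(morph_J step_jM).
congr (step_j _); rewrite vactE pi kap_lam -iM lamJ frame_conj.
by rewrite /step_p !conjgM.
Qed.

Definition step_good (v w : step) : Prop :=
  [~ v, w] = step_i (lam (step_p v) (step_p w)).

Lemma step_goodMl v v' w : step_good v w -> step_good v' w -> step_good (v * v') w.
Proof.
rewrite /step_good => vw v'w.
by rewrite commgMl -conjRg vw v'w step_conj step_pM lamMl step_iM.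
Qed.

Lemma step_good_sym v w : step_good v w -> step_good w v.
Proof.
by rewrite /step_good => vw; rewrite -invgR vw lam_skew (morph_V step_iM) invgK.
Qed.

(** Both sides obey the expansion rules of a crossed pairing, so it suffices
to compare them on [V] and on [K]. *)
Lemma step_good_all v w : step_good v w.
Proof.
have jj x y : step_good (step_j x) (step_j y).
  by rewrite /step_good -(morph_R step_jM) VR !step_p_j.
have js x k : step_good (step_j x) (step_s k).
  rewrite /step_good commgEl step_jJs -(morph_V step_jM) -step_jM vactE mulKg.
  by rewrite step_p_j step_p_s.
have ss k l : step_good (step_s k) (step_s l).
  rewrite /step_good !step_p_s lam_eps (morph_1 step_iM) -(morph_R step_sM).
  by rewrite (_ : [~ k, l] = 1) ?(morph_1 step_sM) //; apply/eqP/commgP/K_comm.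
rewrite (step_split v) (step_split w); apply: step_goodMl; apply: step_good_sym;
  apply: step_goodMl => //; exact: step_good_sym.
Qed.

Lemma step_frame : frame step_p step_i.
Proof.
split; [exact: step_pM | exact: step_iM | exact: step_i_inj | | exact: step_good_all].
by move=> t; rewrite /step_i step_p_j.
Qed.

End Step.

(** A cyclic subgroup can be adjoined to a frame, since the pairing vanishes
on the diagonal. *)
Section Cyclic.
Variable g : G.

Definition in_cyclic : pred G := fun x => `[< generated (fun y => y = g) x >].

Lemma in_cyclic_group_closed : group_closed in_cyclic.
Proof.
split=> [|x y /asboolP xS /asboolP yS]; apply/asboolP; first exact: generated1.
by apply: generatedM => //; apply: generatedV.
Qed.

Definition cyclic := {x : G | in_cyclic x}.
HB.instance Definition _ := SubChoice.on cyclic.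
HB.instance Definition _ :=
  SubChoice_isSubGroup.Build G in_cyclic cyclic in_cyclic_group_closed.

Lemma cyclic_comm (k l : cyclic) : k * l = l * k.
Proof.
apply: val_inj; rewrite !valM.
case: k l => [x /= /asboolP xg] [y /= /asboolP yg].
have gy : commute g y.
  elim: yg => {x y xg} [_ -> //||x y _ gx _ gy|x _ gx].
  - exact: commute1.
  - exact: commuteM.
  - exact: commuteV.
apply: commute_sym; elim: xg => {x} [_ -> ||x x' _ gx _ gy'|x _ gx].
- exact: commute_sym.
- exact: commute1.
- exact: commuteM.
- exact: commuteV.
Qed.

Lemma cyclic_ind (Q : G -> Prop) : Q 1 -> Q g ->
  (forall k l : cyclic, Q (val k) -> Q (val l) -> Q (val k * val l)) ->
  (forall k : cyclic, Q (val k) -> Q (val k)^-1) -> forall k : cyclic, Q (val k).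
Proof.
move=> Q1 Qg QM QV [x /= xg]; have /asboolP := xg; elim=> {x xg} [_ -> //|//|x y|x].
- move=> xg Qx yg Qy.
  exact: (QM (exist in_cyclic x (asboolT xg)) (exist in_cyclic y (asboolT yg))).
- by move=> xg Qx; exact: (QV (exist in_cyclic x (asboolT xg))).
Qed.

Lemma val_cyclicM (k l : cyclic) : val (k * l) = val k * val l.
Proof. exact: valM. Qed.

Lemma cyclicJ (k l : cyclic) : val k ^ val l = val k.
Proof. by rewrite /conjg -!val_cyclicM cyclic_comm val_cyclicM mulKg. Qed.

Lemma lam_cyclic (k l : cyclic) : lam (val k) (val l) = 1.
Proof.
have lamM (x y z : cyclic) :
    lam (val x * val y) (val z) = lam (val x) (val z) * lam (val y) (val z).
  by rewrite lamMl !cyclicJ.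
have lamV (x z : cyclic) : lam (val x)^-1 (val z) = (lam (val x) (val z))^-1.
  apply: (mulgI (lam (val x) (val z))); rewrite mulgV.
  by have := lamM x x^-1 z; rewrite (morph_V val_cyclicM) mulgV lam1l.
have gc : in_cyclic g by apply/asboolP/generated_in.
pose g' : cyclic := exist in_cyclic g gc.
have key (x z : cyclic) : lam (val g') (val z) = 1 -> lam (val x) (val z) = 1.
  move=> gz; move: x; apply: (@cyclic_ind (fun x => lam x (val z) = 1)) => //.
  - exact: lam1l.
  - by move=> x y xz yz; rewrite lamM xz yz mulg1.
  - by move=> x xz; rewrite lamV xz invg1.
apply: (key); rewrite lam_skew (key) ?invg1 //; exact: lam_diag.
Qed.

End Cyclic.

Theorem frame_cover (s : seq G) : exists (V : groupType) (p : V -> G) (i : E -> V),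
  frame p i /\ forall x, x \in s -> exists v, p v = x.
Proof.
elim: s => [|g s [V [p [i [Vf Vs]]]]]; first by exists E, kap, id; split=> //; exact: frame_base.
pose vact (v : V) (k : cyclic g) := v * i (lam (p v) (val k)).
have vactE v k : vact v k = v * i (lam (p v) (val k)) by [].
have f := step_frame Vf (@val_cyclicM g) (@cyclic_comm g) (@lam_cyclic g) vactE.
eexists; eexists; eexists; split; first exact: f.
have [pM _ _ _ _] := Vf.
have gc : in_cyclic g g by apply/asboolP/generated_in.
move=> x; rewrite inE => /orP[/eqP ->|/Vs[v <-]].
  by eexists; exact: (step_p_s Vf (@val_cyclicM g) (@cyclic_comm g) vactE (exist (in_cyclic g) g gc)).
by eexists; exact: (step_p_j Vf (@val_cyclicM g) (@cyclic_comm g) vactE v).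
Qed.

Hypothesis lam_gen : forall t, exists u, t = word_eval (fun q => lam q.1 q.2) u.
Hypothesis H2G : is_trivial (group_homology G 2).

(** The element [t] is a product of commutators in a frame that attains the
letters of the product and all entries of a 3-chain bounding its cycle; in
that frame the product is the value of a cocycle on a boundary. *)
Theorem kap_ker t : kap t = 1 -> t = 1.
Proof.
have [u ->] := lam_gen t => {t} u1.
pose w := commutator_word u.
have w1 : word_value w = 1.
  rewrite /word_value word_eval_commutator -[RHS]u1.
  elim: u {w u1} => [|[q b] u IH] /=; first by rewrite (morph_1 kapM).
  by rewrite kapM IH; case: b; rewrite ?(morph_V kapM) kap_lam.
have [c cE] : exists c : bar_chain G 3, bar_diff c = word_chain w.
  apply: (homology_exact H2G).
  by rewrite bar_diff_word_chain w1 word_exp_commutator; zmod.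
(* These elements, with the letters of the word, make the cocycle of the
   extension meaningful on every entry of [c]. *)
pose entries := flatten [seq (val t : seq G) | t <- dom c].
have [V [p [i [[pM iM i_inj piE VR] cover]]]] := frame_cover
  (entries ++ [seq l.1.1 | l <- u] ++ [seq l.1.2 | l <- u]).
have p_central v : p v = 1 -> in_centre v.
  move=> v1; apply/asboolP => v'; apply/commgP; rewrite VR v1.
  by rewrite lam1l (morph_1 iM).
have uV l : l \in u -> attained p l.1.1 /\ attained p l.1.2.
  by move=> lu; split; apply: cover; rewrite !mem_cat (map_f _ lu) ?orbT.
have wV l : l \in w -> attained p l.1.
  move=> /flattenP[l' /mapP[[[g h] b] /uV ghV ->]].
  have {ghV} [gV hV] : attained p g /\ attained p h by [].
  by case: b; rewrite !inE => /or4P[] /eqP ->.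
have c0 : section_ext p (word_chain w) = 0%R.
  rewrite -cE; pose f := section_ext p \o @bar_diff G 2.
  apply: (additive_eq0_dom (f := f)) => t tc.
  have tV x : x \in (val t : seq G) -> attained p x.
    move=> xt; apply: cover; rewrite mem_cat; apply/orP; left.
    by apply/flattenP; exists (val t) => //; apply: map_f.
  have [x [y [z tE]]] := tuple3P t; rewrite tE in tV *.
  by apply: section_ext_boundary => //; apply: tV; rewrite !inE eqxx ?orbT.
apply: i_inj; rewrite (morph_1 iM).
have -> : i (word_eval (fun q => lam q.1 q.2) u) = word_eval (section_of p) w.
  rewrite word_eval_commutator.
  elim: u uV {u1 w w1 cE c0 wV cover} => [|[[g h] b] u IH] uV /=; first exact: (morph_1 iM).
  rewrite iM IH; last by move=> l lu; apply: uV; rewrite inE lu orbT.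
  have gV : attained p g by have [] := uV (g, h, b) (mem_head _ _).
  have hV : attained p h by have [] := uV (g, h, b) (mem_head _ _).
  congr (_ * _); case: b {uV gV hV} (gV) (hV) => gV hV; rewrite ?(morph_V iM) VR !section_ofK //.
apply: (mulIg (section_of p 1)); rewrite (word_eval_section pM p_central wV).
by rewrite c0 w1.
Qed.

End Frames.

(** * Surjectivity of Psi when the second homology vanishes *)
Section ExteriorSquare.
Variable G : groupType.
Local Notation T := (tensor_square G).

(** Dividing out the squares [g (x) g] makes the pairing vanish on the
diagonal. *)
Definition exterior_square : groupType := cquot (@Psi G).
Local Notation E := exterior_square.
Definition wedge (g h : G) : E := cquot_pi (@Psi G) (otimes g h).
Definition wedge_comm (x : E) : G := tcomm (repr x).

Lemma wedge_commE t : wedge_comm (cquot_pi (@Psi G) t) = tcomm t.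
Proof.
rewrite /wedge_comm; have [w ->] := cquot_pi_repr (@Psi G) t.
by rewrite tcommM tcomm_Psi mulg1.
Qed.

Lemma wedge_commM : {morph wedge_comm : x y / x * y}.
Proof.
move=> x y; have [s ->] := cquotP x; have [t ->] := cquotP y.
by rewrite -cquot_piM !wedge_commE tcommM.
Qed.

Lemma wedgeMl g g1 h : wedge (g * g1) h = wedge (g ^ g1) (h ^ g1) * wedge g1 h.
Proof. by rewrite /wedge otimes_Ml cquot_piM. Qed.
Lemma wedgeMr g h h1 : wedge g (h * h1) = wedge g h1 * wedge (g ^ h1) (h ^ h1).
Proof. by rewrite /wedge otimes_Mr cquot_piM. Qed.
Lemma wedge_diag g : wedge g g = 1.
Proof. by apply/cquot_kerP; exists (gm (ab g)); rewrite Psi_gm. Qed.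
Lemma wedge_skew g h : wedge h g = (wedge g h)^-1.
Proof.
apply: (mulgI (wedge g h)); rewrite mulgV -cquot_piM -/(otimes_sym g h).
have := congr1 (cquot_pi (@Psi G)) (otimes_sqM g h).
by rewrite !cquot_piM -!/(wedge _ _) !wedge_diag !mul1g => <-.
Qed.
Lemma wedge_comm_wedge g h : wedge_comm (wedge g h) = [~ g, h].
Proof. by rewrite wedge_commE tcomm_otimes. Qed.
Lemma wedgeJ g h x : wedge g h * wedge [~ g, h] x = wedge (g ^ x) (h ^ x).
Proof. by rewrite /wedge -cquot_piM otimes_commg mulVKg tact_otimes. Qed.
Lemma wedge_comm_comm s t : wedge (wedge_comm s) (wedge_comm t) = [~ s, t].
Proof.
have [s' ->] := cquotP s; have [t' ->] := cquotP t; rewrite !wedge_commE /wedge.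
by rewrite otimes_tcomm -conj_tensor -commgEl (morph_R (@cquot_piM _ _ _)).
Qed.

Lemma wedge_gen x : exists u, x = word_eval (fun q => wedge q.1 q.2) u.
Proof.
have [t ->] := cquotP x; elim/quotW: t => u; exists u.
rewrite pi_word; elim: u => [|[[g h] b] u IH] /=; first exact: (cquot_pi1 (@Psi G)).
by rewrite -IH cquot_piM; congr (_ * _); case: b; rewrite ?cquot_piV.
Qed.

(** By [kap_ker] for the quotient by the image of [Psi]. *)
Theorem tcomm_ker_Psi : is_trivial (group_homology G 2) ->
  forall t : T, tcomm t = 1 -> exists w, t = val (Psi w).
Proof.
move=> H2G t t1; apply/cquot_kerP.
apply: (kap_ker wedge_commM wedgeMl wedgeMr wedge_diag wedge_skew
  wedge_comm_wedge wedgeJ wedge_comm_comm wedge_gen H2G).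
by rewrite wedge_commE.
Qed.

End ExteriorSquare.

(** * Extension of homomorphisms into divisible groups *)
Local Open Scope ring_scope.

Section DivisibleExtension.
Variables (V Gam : zmodType).
Hypothesis Gam_div : divisible Gam.

(** Partial homomorphisms are encoded by their graphs, so that the union of a
chain is again one. *)
Record partial_hom := PartialHom {
  ph_rel :> V -> Gam -> Prop;
  ph0 : ph_rel 0 0;
  phB : forall u v a b, ph_rel u a -> ph_rel v b -> ph_rel (u - v) (a - b);
  ph_fun : forall a, ph_rel 0 a -> a = 0 }.

Definition ph_le (R S : partial_hom) : Prop := forall v a, R v a -> S v a.

Lemma phN (R : partial_hom) u a : R u a -> R (- u) (- a).
Proof. by move=> Ru; rewrite -(sub0r u) -(sub0r a); apply: phB => //; apply: ph0. Qed.
Lemma phD (R : partial_hom) u v a b : R u a -> R v b -> R (u + v) (a + b).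
Proof. by move=> Ru Rv; rewrite -(opprK v) -(opprK b); apply: phB => //; apply: phN. Qed.
Lemma phMn (R : partial_hom) u a n : R u a -> R (u *+ n) (a *+ n).
Proof.
by move=> Ru; elim: n => [|n IH]; [exact: ph0 | rewrite !mulrS; apply: phD].
Qed.
Lemma phMz (R : partial_hom) u a m : R u a -> R (u *~ m) (a *~ m).
Proof.
move=> Ru; case: m => n; first by rewrite -!pmulrn; apply: phMn.
by rewrite NegzE !mulrNz -!pmulrn; apply/phN/phMn.
Qed.
Lemma ph_uniq (R : partial_hom) u a b : R u a -> R u b -> a = b.
Proof.
move=> Ra Rb; apply/eqP; rewrite -subr_eq0; apply/eqP; apply: (ph_fun (p := R)).
by rewrite -(subrr u); apply: phB.
Qed.

(** The multiples of [v] in the domain are the multiples of one [n]; dividing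
the value at [n v] by [n] gives a value for [v] compatible with all of them.
*)
Lemma ph_value (R : partial_hom) (v : V) :
  exists y, forall m a, R (v *~ m) a -> a = y *~ m.
Proof.
have [[n [n0 [a Ra]]]|none] :=
    pselect (exists n : nat, (0 < n)%N /\ exists a, R (v *+ n) a); last first.
  exists 0 => -[n|n] a Ra; rewrite mul0rz.
    case: n Ra => [|n] Ra; first by apply: (ph_fun (p := R)); rewrite -(mulr0z v).
    by case: none; exists n.+1; split=> //; exists a.
  case: none; exists n.+1; split=> //; exists (- a).
  by rewrite -[v *+ _]opprK; apply: phN; move: Ra; rewrite NegzE mulrNz -pmulrn.
pose P n := (0 < n)%N && `[< exists a, R (v *+ n) a >].
have exP : exists n, P n.
  by exists n; rewrite /P n0; apply/asboolP; exists a.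
case: (ex_minnP exP) => {n n0 a Ra} n /andP[n0 /asboolP[d Rd]] n_min.
have [y yd] := Gam_div d n0; exists y => m a Ra.
have n0' : (n%:Z != 0)%R by rewrite -lt0n.
pose r := `|(m %% n%:Z)%Z|%N.
have rE : (m %% n%:Z)%Z = r%:Z by rewrite gez0_abs // modz_ge0.
have Rr : R (v *+ r) (a - d *~ (m %/ n%:Z)%Z).
  have -> : v *+ r = v *~ m - (v *+ n) *~ (m %/ n%:Z)%Z.
    have E : v *~ ((m %/ n%:Z)%Z * n%:Z) = v *+ n *~ (m %/ n%:Z)%Z.
      by rewrite pmulrn -mulrzA mulrC.
    by rewrite [in v *~ m](divz_eq m n%:Z) mulrzDr E rE -pmulrn; zmod.
  by apply: phB => //; apply: phMz.
have r0 : r = 0%N.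
  apply/eqP; rewrite -leqn0 leqNgt; apply/negP => r_gt0.
  have : (n <= r)%N by apply: n_min; rewrite /P r_gt0; apply/asboolP; eexists; exact: Rr.
  rewrite leqNgt => /negP; apply.
  by rewrite -ltz_nat -rE ltz_pmod // ltz_nat.
move: Rr; rewrite r0 mulr0n => /ph_fun/eqP; rewrite subr_eq0 => /eqP ->.
rewrite -yd pmulrn -mulrzA; congr (y *~ _).
by rewrite [m in RHS](divz_eq m n%:Z) rE r0 addr0 mulrC.
Qed.

Lemma ph_extend (R : partial_hom) (v : V) :
  exists S : partial_hom, ph_le R S /\ exists a, S v a.
Proof.
have [y yP] := ph_value R v.
(* The relation spanned by [R] and the pair [(v, y)]. *)
pose S u a := exists u' b m, [/\ R u' b, u = u' + v *~ m & a = b + y *~ m].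
have S0 : S 0 0 by exists 0, 0, 0; split; rewrite ?mulr0z ?addr0 //; apply: ph0.
have SB u w a b : S u a -> S w b -> S (u - w) (a - b).
  move=> [u' [a' [m [Ru -> ->]]]] [w' [b' [l [Rw -> ->]]]].
  exists (u' - w'), (a' - b'), (m - l); split; [exact: phB | |];
    by rewrite mulrzBr; zmod.
have SF a : S 0 a -> a = 0.
  move=> [u [b [m [Ru /esym/eqP]]]]; rewrite addr_eq0 => /eqP uE ->.
  have := yP m (- b); rewrite -[v *~ m]opprK -uE => /(_ (phN Ru)) <-.
  exact: addrN.
exists (PartialHom S0 SB SF); split=> [u a Ru|].
  by exists u, a, 0; rewrite !mulr0z !addr0.
by exists y, 0, 0, 1; rewrite !mulr1z !add0r; split=> //; apply: ph0.
Qed.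

(** A maximal extension of [R], given by Zorn's lemma, is total because of
[ph_extend]. *)
Theorem divisible_extension (R : partial_hom) :
  exists K : V -> Gam, {morph K : u v / u - v} /\ forall v a, R v a -> K v = a.
Proof.
pose T := {S : partial_hom | ph_le R S}.
pose le (S S' : T) := `[< ph_le (sval S) (sval S') >].
have Tt : T by exists R.
have [|||M Mmax] := @ZL_preorder T Tt le.
- by move=> S; apply/asboolP => v a.
- by move=> S' S S'' /asboolP SS' /asboolP S'S''; apply/asboolP => v a /SS'/S'S''.
- move=> A Atot; have [A0|] := pselect (exists S, A S); last first.
    move=> none; exists Tt => S AS.
    by case: none; exists S.
  pose U u a := exists2 S, A S & sval S u a.
  have U0 : U 0 0 by have [S AS] := A0; exists S => //; apply: ph0.
  have UB u v a b : U u a -> U v b -> U (u - v) (a - b).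
    move=> [S AS Su] [S' AS' S'v].
    have [/asboolP SS'|/asboolP S'S] := Atot _ _ AS AS'.
      by exists S' => //; apply: phB => //; apply: SS'.
    by exists S => //; apply: phB => //; apply: S'S.
  have UF a : U 0 a -> a = 0 by move=> [S _]; apply: ph_fun.
  have RU : ph_le R (PartialHom U0 UB UF).
    by have [S AS] := A0; move=> v a Ra; exists S => //; apply: (svalP S).
  exists (exist _ _ RU) => S AS; apply/asboolP => v a Sv.
  by exists S.
have total v : exists a, sval M v a.
  have [S [MS [a Sv]]] := ph_extend (sval M) v.
  have RS : ph_le R S by move=> u b Rub; apply: MS; apply: (svalP M).
  have /asboolP SM := Mmax (exist _ S RS) (asboolT MS).
  by exists a; apply: SM.
pose K v := sval (cid (total v)).
have KP v : sval M v (K v) by exact: svalP (cid (total v)).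
exists K; split=> [u v|v a Ra].
  by apply: (ph_uniq (KP _)); apply: phB.
by apply: (ph_uniq (KP _)); apply: (svalP M).
Qed.

End DivisibleExtension.

(** * Splitting of the central extension *)
Local Open Scope ring_scope.

Section CocycleSplitting.
Variables (D : groupType) (Gam : zmodType).
Local Notation C1 := {freeg (1.-tuple D) / int}.
Local Notation C2 := {freeg (2.-tuple D) / int}.

Definition cocycle2 (f : D -> D -> Gam) : Prop := forall x y z,
  f y z - f (x * y)%g z + f x (y * z)%g - f x y = 0.

(** Vanishing of second cohomology with trivial coefficients, stated with
functions of two variables. *)
Definition cocycles_split : Prop := forall f, cocycle2 f ->
  exists k : D -> Gam, forall x y, f x y = k y - k (x * y)%g + k x.

Lemma split_of_cohomology : is_trivial (group_cohomology D Gam 2) -> cocycles_split.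
Proof.
move=> H2 f fC; pose c : bar_cochain D Gam 2 := fun t => f (tnth t ord0) (tnth t ord_max).
have cE x y : c [tuple x; y] = f x y by rewrite /c !(tnth_nth 1%g).
have [|k kE] := @cohomology_exact D Gam 1 H2 c.
  move=> t; have [x [y [z ->]]] := tuple3P t.
  by rewrite bar_codiff2E !cE fC.
exists (fun x => k [tuple x]) => x y; rewrite -cE -kE; exact: bar_codiff1E.
Qed.

Section FromHomology.
Hypothesis H2D : is_trivial (group_homology D 2).
Variable f : D -> D -> Gam.
Hypothesis fC : cocycle2 f.

Definition cocycle_ext : C2 -> Gam :=
  fgext (fun t : 2.-tuple D => f (tnth t ord0) (tnth t ord_max)).
HB.instance Definition _ := GRing.Additive.copy cocycle_ext
  (fgext (fun t : 2.-tuple D => f (tnth t ord0) (tnth t ord_max))).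

Lemma cocycle_ext2 x y : cocycle_ext (bar2 x y) = f x y.
Proof. by rewrite /cocycle_ext fgextU !(tnth_nth 1%g). Qed.
Lemma cocycle_extD : {morph cocycle_ext : a b / a + b}. Proof. exact: raddfD. Qed.
Lemma cocycle_extB : {morph cocycle_ext : a b / a - b}. Proof. exact: raddfB. Qed.

Lemma cocycle_ext_cycle (z : C2) : bd2 z = 0 -> cocycle_ext z = 0.
Proof.
move=> z0; have [c <-] := homology_exact H2D z0.
move: c; apply: freeg_gen_ind => [|a b fa fb|t]; first by rewrite !raddf0.
  by rewrite !raddfB /= fa fb subrr.
have [x [y [w ->]]] := tuple3P t; rewrite -/(bar3 x y w) bar_diff2U.
by rewrite !(cocycle_extB, cocycle_extD) !cocycle_ext2 fC.
Qed.

(** Since 2-cycles are boundaries, the linear extension of a cocycle only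
depends on the boundary of its argument. *)
Lemma cocycle_ext_bd (p q : C2) : bd2 p = bd2 q -> cocycle_ext p = cocycle_ext q.
Proof.
move=> pq; apply/eqP; rewrite -subr_eq0 -cocycle_extB; apply/eqP/cocycle_ext_cycle.
by rewrite bd2B pq subrr.
Qed.

(** Extend the homomorphism [bd2 p |-> cocycle_ext p] from boundaries to all
1-chains; its values on group elements are the required cochain. *)
Lemma split_of_divisible : divisible Gam ->
  exists k : D -> Gam, forall x y, f x y = k y - k (x * y)%g + k x.
Proof.
(* The homomorphism induced by the cocycle on boundaries. *)
move=> Gdiv; pose R (v : C1) (a : Gam) := exists p, v = bd2 p /\ a = cocycle_ext p.
have R0 : R 0 0 by exists 0; rewrite !raddf0.
have RB u v a b : R u a -> R v b -> R (u - v) (a - b).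
  move=> [p [-> ->]] [q [-> ->]]; exists (p - q); by rewrite bd2B cocycle_extB.
have RF a : R 0 a -> a = 0.
  by move=> [p [p0 ->]]; apply: cocycle_ext_cycle.
have [K [KB KR]] := divisible_extension Gdiv (PartialHom R0 RB RF).
have KD u v : K (u + v) = K u + K v.
  have K0 : K 0 = 0 by have := KB 0 0; rewrite subrr => E; zmod_from E.
  have KN w : K (- w) = - K w by rewrite -sub0r KB K0 sub0r.
  by rewrite -[v in LHS]opprK KB KN opprK.
exists (fun x => K (bar1 x)) => x y; rewrite -cocycle_ext2 -KB -KD -bd2E.
by apply/esym/KR; exists (bar2 x y).
Qed.

(** Modulo boundaries, [bar1 x + bar1 y] is [bar1 (x * y)]. *)
Lemma chain1_class (c : C1) : exists x p, c = bar1 x + bd2 p.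
Proof.
have bar1_1 : bar1 1 = bd2 (bar2 1%g (1%g : D)) by rewrite bd2E mulg1; zmod.
move: c; apply: bar1_ind => [|a b [x [p ->]] [y [q ->]]|x].
- by exists 1%g, (- bar2 1%g 1%g); rewrite raddfN /= -bar1_1; zmod.
- exists (x * y^-1)%g, (p - q + bar2 x y^-1%g - bar2 y y^-1%g - bar2 1%g 1%g).
  rewrite !bd2B bd2D bd2B -bar1_1 !bd2E mulgV; zmod.
- by exists x, 0; rewrite raddf0 addr0.
Qed.

Lemma derived_boundary (x : D) : in_derived x -> exists p, bar1 x = bd2 p.
Proof.
have bar1M (y z : D) : bar1 (y * z)%g = bar1 y + bar1 z - bd2 (bar2 y z).
  by rewrite bd2E; zmod.
have bar1_1 : bar1 1 = bd2 (bar2 1%g (1%g : D)) by rewrite bd2E mulg1; zmod.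
move=> /asboolP; elim=> {x} [x [a [b ->]]||x y _ [p pE] _ [q qE]|x _ [p pE]].
(* [a * b] is both a product of [a] and [b] and one of [b * a] and [~ a, b].
   *)
- exists (bar2 b a - bar2 a b + bar2 (b * a)%g [~ a, b]%g).
  by rewrite bd2D bd2B !bd2E -commgC; zmod.
- by exists (bar2 1%g 1%g).
- by exists (p + q - bar2 x y); rewrite bar1M pE qE bd2B bd2D.
- by exists (bar2 x x^-1%g + bar2 1%g 1%g - p); rewrite bd2B bd2D -pE -bar1_1 bd2E mulgV; zmod.
Qed.

Lemma ab_ext_ker (c : C1) : ab_ext c = 0 -> exists p, c = bd2 p.
Proof.
have [x [p ->]] := chain1_class c.
rewrite raddfD /= ab_ext_bd2 addr0 ab_ext1 => /ab_eq0P/derived_boundary[q ->].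
by exists (q + p); rewrite bd2D.
Qed.

(** A basis of the abelianization gives a section [S] of the map from
1-chains, so [bar1 x - S x] is a boundary; the cochain is the cocycle on a
2-chain bounding it. *)
Lemma split_of_free : free_abelian (abelianization D) ->
  exists k : D -> Gam, forall x y, f x y = k y - k (x * y)%g + k x.
Proof.
move=> [X [g [g' gK g'K]]].
pose S : {additive {freeg X / int} -> C1} := fgext (fun x : X => bar1 (repr (g' << x >>))).
have SE w : ab_ext (S w) = g' w.
  apply: (can_inj gK); rewrite g'K; move: w; apply: freeg_gen_ind => [|a b wa wb|x].
  - by rewrite !raddf0.
  - by rewrite !raddfB /= wa wb.
  - by rewrite [S _]fgextU ab_ext1 /ab reprK g'K.
have SX (x : D) : exists p, bar1 x - S (g (ab x)) = bd2 p.
  by apply: ab_ext_ker; rewrite raddfB /= SE gK ab_ext1 subrr.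
pose p x := sval (cid (SX x)).
have pE x : bar1 x - S (g (ab x)) = bd2 (p x) by exact: svalP (cid (SX x)).
exists (fun x => cocycle_ext (p x)) => x y.
rewrite -cocycle_ext2 -cocycle_extB -cocycle_extD; apply: cocycle_ext_bd.
rewrite bd2E bd2D bd2B -!pE abM !raddfD /=; zmod.
Qed.

End FromHomology.
End CocycleSplitting.

Section TensorSplitting.
Variable G : groupType.
Local Notation T := (tensor_square G).
Local Notation D := (derived G).
Local Notation Gam := (Gamma (abelianization G)).
Hypothesis H2G : is_trivial (group_homology G 2).
Hypothesis H3G : is_trivial (group_homology G 3).

(** Correcting a set-theoretic section of the commutator map by a cochain that
splits its cocycle gives a homomorphism, and the central kernel becomes a
direct factor. *)
Lemma tensor_isomorphic : cocycles_split D Gam ->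
  isomorphic T (GRing.to_multiplicative Gam * D)%type.
Proof.
move=> split.
have lift (x : D) : exists t : T, tcomm t = val x by apply: tcomm_ex; apply: (valP x).
pose s x := sval (cid (lift x)).
have sE x : tcomm (s x) = val x by exact: svalP (cid (lift x)).
have fac (x y : D) : exists w, (s x * s y * (s (x * y))^-1)%g = val (Psi w).
  apply: tcomm_ker_Psi => //.
  by rewrite !tcommM (morph_V (@tcommM G)) !sE valM mulgV.
pose f x y := sval (cid (fac x y)).
have fE x y : (s x * s y = val (Psi (f x y)) * s (x * y))%g.
  by rewrite -(svalP (cid (fac x y))) mulgVK.
have PsiD (a b : Gam) : val (Psi (a + b)) = (val (Psi a) * val (Psi b))%g.
  by rewrite raddfD.
have PsiV_inj (a b : Gam) : val (Psi a) = val (Psi b) -> a = b.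
  by move=> /val_inj; exact: Psi_inj.
have [x y z|k kE] := split f.
  suff E : f y z + f x (y * z)%g = f x y + f (x * y)%g z by zmod_from E.
  apply: PsiV_inj; rewrite !PsiD; apply: (mulIg (s (x * y * z)%g)).
  transitivity (s x * s y * s z)%g; last first.
    by rewrite -[RHS]mulgA -(fE (x * y)%g) [RHS]mulgA -(fE x y).
  rewrite -[(x * y * z)%g]mulgA -[LHS]mulgA -(fE x) [LHS]mulgA val_centreC.
  by rewrite -[LHS]mulgA -(fE y) mulgA.
pose s' x := (s x * val (Psi (- k x)))%g.
have s'M : {morph s' : x y / (x * y)%g >-> (x * y)%g}.
  move=> x y; rewrite /s' mulgA -(mulgA (s x)) val_centreC mulgA fE.
  rewrite -!mulgA -PsiD [RHS]val_centreC -!mulgA -PsiD; congr (_ * val (Psi _))%g.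
  by rewrite kE; zmod.
have s'E x : tcomm (s' x) = val x by rewrite /s' tcommM tcomm_Psi mulg1 sE.
move: s' s'M s'E => s' s'M s'E.
pose F (w : (GRing.to_multiplicative Gam * D)%type) : T :=
  (val (Psi (w.1 : Gam)) * s' w.2)%g.
have FM : {morph F : v w / (v * w)%g}.
  move=> [a x] [b y]; rewrite /F /= s'M PsiD -!mulgA; congr (_ * _)%g.
  by rewrite !mulgA val_centreC.
apply: (isomorphic_sym FM).
have ker_s' t : exists w, exists x : D, t = (val (Psi w) * s' x)%g.
  have [w wE] : exists w, (t * (s' (Sub (tcomm t) (in_derived_tcomm t)))^-1)%g
      = val (Psi w).
    by apply: tcomm_ker_Psi => //; rewrite tcommM (morph_V (@tcommM G)) s'E mulgV.
  by exists w, (Sub (tcomm t) (in_derived_tcomm t)); rewrite -wE mulgVK.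
pose F' (t : T) : (GRing.to_multiplicative Gam * D)%type :=
  (sval (cid (ker_s' t)), sval (cid (svalP (cid (ker_s' t))))).
have F'K : cancel F' F.
  by move=> t; rewrite /F /F' /=; rewrite -(svalP (cid (svalP (cid (ker_s' t))))).
have F_inj : injective F.
  move=> [a x] [b y]; rewrite /F /= => ab.
  have xy : x = y.
    by apply: val_inj; have := congr1 (@tcomm G) ab; rewrite !tcommM !tcomm_Psi !mul1g !s'E.
  by move: ab; rewrite xy => /mulIg/PsiV_inj ->.
by exists F' => // w; apply: F_inj; rewrite F'K.
Qed.

End TensorSplitting.

(** * Finite generation and integer lattices *)
Local Open Scope ring_scope.

Section GammaGenerated.
Variable G : groupType.
Local Notation Gam := (Gamma (abelianization G)).

Definition int_comb (V : zmodType) (s : seq V) (x : 'rV[int]_(size s)) : V :=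
  \sum_(i < size s) s`_i *~ x 0 i.

Lemma int_combB (V : zmodType) (s : seq V) : {morph @int_comb V s : x y / x - y}.
Proof.
move=> x y; rewrite /int_comb -sumrB; apply: eq_bigr => i _.
by rewrite !mxE mulrzBr.
Qed.

Lemma int_combD (V : zmodType) (s : seq V) : {morph @int_comb V s : x y / x + y}.
Proof.
move=> x y; rewrite /int_comb -big_split; apply: eq_bigr => i _.
by rewrite !mxE mulrzDr.
Qed.

Lemma int_comb_mem (V : zmodType) (s : seq V) v : v \in s ->
  exists x, int_comb (s := s) x = v.
Proof.
move=> vs; have vs' : (index v s < size s)%N by rewrite index_mem.
exists (delta_mx 0 (Ordinal vs')); rewrite /int_comb (bigD1 (Ordinal vs')) //= big1.
  by rewrite addr0 mxE !eqxx /= mulr1z nth_index.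
by move=> i /negPf iv; rewrite mxE eqxx iv mulr0z.
Qed.

(** If [g] and [h] run over generators of [G], then the elements [gm g] and
[pol g h] generate: [pol] is biadditive, and [gm (a + b)] differs from [gm a +
gm b] by [pol a b]. *)
Lemma Gamma_fg : finitely_generated G ->
  exists s : seq Gam, forall w, exists x, int_comb (s := s) x = w.
Proof.
move=> [s sG].
(* Values of [gm] on the generators and of [pol] on pairs of them. *)
pose gs : seq Gam := [seq gm (ab g) | g <- s]
  ++ [seq pol (ab g) (ab h) | g <- s, h <- s].
exists gs; pose Z w := exists x, int_comb (s := gs) x = w.
have Z0 : Z 0.
  by exists 0; rewrite /int_comb big1 // => i _; rewrite mxE mulr0z.
have ZB v w : Z v -> Z w -> Z (v - w).
  by move=> [x <-] [y <-]; exists (x - y); rewrite int_combB.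
have ZN v : Z v -> Z (- v) by move=> Zv; rewrite -sub0r; apply: ZB.
have ZD v w : Z v -> Z w -> Z (v + w).
  by move=> Zv Zw; rewrite -[w]opprK; apply: ZB => //; apply: ZN.
have Zgm g : g \in s -> Z (gm (ab g)).
  by move=> gs'; apply: int_comb_mem; rewrite mem_cat; apply/orP; left; apply/mapP; exists g.
have Zpol g h : g \in s -> h \in s -> Z (pol (ab g) (ab h)).
  move=> g_s h_s; apply: int_comb_mem; rewrite mem_cat; apply/orP; right.
  by apply/allpairsP; exists (g, h).
have Zpoll x h : h \in s -> Z (pol (ab x) (ab h)).
  move=> hs; elim: (sG x) => {x} [x|//||].
  - by move=> xs; apply: Zpol.
  - by rewrite ab1 pol0l.
  - by move=> x y _ Zx _ Zy; rewrite abM polDl; apply: ZD.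
  - by move=> x _ Zx; rewrite abV polNl; apply: ZN.
have Zpolall x y : Z (pol (ab x) (ab y)).
  elim: (sG y) => {y} [y||y z _ Zy _ Zz|y _ Zy].
  - by move=> ys; apply: Zpoll.
  - by rewrite ab1 pol0r.
  - by rewrite abM polDr; apply: ZD.
  - by rewrite abV polNr; apply: ZN.
apply: Gamma_ind => // a; have [x ->] := abP a.
elim: (sG x) => {x} [x||x y _ Zx _ Zy|x _ Zx].
- exact: Zgm.
- by rewrite ab1 gm0.
- by rewrite abM gmD; apply: (ZD) => //; apply: ZD.
- by rewrite abV gmN.
Qed.

End GammaGenerated.

(** By induction on [n]: the first coordinates form an ideal, generated by
that of some [r], and subtracting a multiple of [r] leaves a vector of smaller
dimension. *)
Lemma int_lattice n (K : 'rV[int]_n -> Prop) :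
  K 0 -> (forall x y, K x -> K y -> K (x - y)) ->
  exists M : 'M[int]_n, forall x, K x <-> exists y, x = y *m M.
Proof.
elim: n K => [|n IH] K K0 KB.
  exists 0 => x; split=> [_|_]; last by rewrite [x]thinmx0.
  by exists 0; rewrite [x]thinmx0 mul0mx.
have KN v : K v -> K (- v) by move=> Kv; rewrite -sub0r; apply: KB.
have KD v w : K v -> K w -> K (v + w).
  by move=> Kv Kw; rewrite -[w]opprK; apply: KB => //; apply: KN.
have KMn v m : K v -> K (v *+ m).
  by move=> Kv; elim: m => [|m IHm]; rewrite ?mulr0n // mulrS; apply: KD.
have KM v m : K v -> K (m *: v).
  move=> Kv; rewrite -[m]intz scaler_int; case: m => m.
    by rewrite -[_ *~ _]pmulrn; apply: KMn.
  by rewrite NegzE mulrNz -pmulrn; apply/KN/KMn.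
pose K' (x : 'rV[int]_n) := K (row_mx (0 : 'rV_1) x).
have [||M' M'E] := IH K'.
- by rewrite /K' row_mx0.
- move=> x y Kx Ky; rewrite /K'.
  have -> : row_mx (0 : 'rV_1) (x - y) = row_mx 0 x - row_mx 0 y.
    by rewrite opp_row_mx add_row_mx subr0.
  exact: KB.
(* The first coordinate of [r] generates the ideal of first coordinates; [r =
   0] when that ideal is zero. *)
have [r [Kr rP]] : exists r : 'rV[int]_(1 + n), K r /\
    forall x : 'rV[int]_(1 + n), K x -> exists m, x 0 0 = m * r 0 0.
  pose P d := (0 < d)%N && `[< exists r : 'rV[int]_(1 + n), K r /\ r 0 0 = d%:Z >].
  have [exP|none] := pselect (exists d, P d); last first.
    exists 0; split=> // x Kx; exists 0; rewrite mul0r; apply/eqP/negPn/negP => x0.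
    case: none; exists (absz (x 0 0)); rewrite /P absz_gt0 x0; apply/asboolP.
    case: (lerP 0 (x 0 0)) => [x_ge0|x_lt0]; first by exists x; rewrite gez0_abs.
    by exists (- x); rewrite mxE ltz0_abs //; split=> //; apply: KN.
  case: (ex_minnP exP) => d /andP[d0 /asboolP[r [Kr rd]]] d_min.
  exists r; split=> // x Kx; pose u := x 0 0; exists (u %/ d%:Z)%Z; rewrite rd -/u.
  have d0' : (d%:Z != 0) by rewrite -lt0n.
  rewrite [LHS](divz_eq _ d%:Z) -[RHS]addr0; congr (_ + _).
  apply/eqP/negPn/negP => m0.
  have m_ge0 := modz_ge0 u d0'.
  have : (d <= `|(u %% d%:Z)%Z|)%N.
    apply: d_min; rewrite /P absz_gt0 m0; apply/asboolP.
    exists (x - (u %/ d%:Z)%Z *: r); split; first by apply: KB => //; apply: KM.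
    by rewrite gez0_abs // !mxE rd -/u {1}[u](divz_eq _ d%:Z) addrC addKr.
  rewrite leqNgt => /negP; apply.
  by rewrite -ltz_nat gez0_abs // ltz_pmod // ltz_nat.
pose M : 'M[int]_(1 + n) := col_mx r (row_mx 0 M').
exists M => x; split=> [Kx|[y ->]].
- have [m xm] := rP x Kx; pose z : 'rV[int]_(1 + n) := x - m *: r.
  have z0 : lsubmx z = 0.
    apply/matrixP => i j; rewrite !ord1 !mxE.
    by rewrite (_ : lshift n 0 = 0) ?xm ?subrr //; apply: val_inj.
  have [y yE] : exists y, rsubmx z = y *m M'.
    by apply/M'E; rewrite /K' -z0 hsubmxK; apply: KB => //; apply: KM.
  have E : row_mx m%:M y *m M = m *: r + z.
    by rewrite mul_row_col mul_scalar_mx mul_mx_row mulmx0 -yE -z0 hsubmxK.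
  by exists (row_mx m%:M y); rewrite [RHS]E /z addrC subrK.
- pose y' : 'rV[int]_(1 + n) := y.
  have -> : y *m M = lsubmx y' 0 0 *: r + rsubmx y' *m row_mx 0 M'.
    have E := mul_row_col (lsubmx y') (rsubmx y') r (row_mx 0 M').
    by rewrite hsubmxK [lsubmx y' in RHS]mx11_scalar mul_scalar_mx in E.
  apply: KD; first exact: KM.
  by rewrite mul_mx_row mulmx0; apply/M'E; eexists.
Qed.

(** * Faithful representations *)

From mathcomp Require Import fingroup perm.
Local Open Scope ring_scope.

(** Kernels are tracked rather than faithful representations, because a
faithful representation is assembled from non-faithful ones by intersecting
kernels. *)
Definition rep_kernel (Q : fieldType) (H : groupType) (K : H -> Prop) : Prop :=
  exists (n : nat) (M : H -> 'M[Q]_n),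
    [/\ (0 < n)%N, forall x y : H, M (x * y)%g = M x *m M y, M 1%g = 1%:M
      & forall x, M x = 1%:M <-> K x].

Section Representations.
Variable Q : fieldType.

Lemma rep_kernel_eq (H : groupType) (K K' : H -> Prop) :
  (forall x, K x <-> K' x) -> rep_kernel Q K -> rep_kernel Q K'.
Proof.
move=> KK' [n [M [n0 MM M1 MK]]]; exists n, M; split=> // x.
exact: iff_trans (MK x) (KK' x).
Qed.

Lemma rep_kernel_comp (H H' : groupType) (f : H' -> H) (K : H -> Prop) :
  {morph f : x y / (x * y)%g} -> rep_kernel Q K -> rep_kernel Q (fun x => K (f x)).
Proof.
move=> fM [n [M [n0 MM M1 MK]]]; exists n, (fun x => M (f x)); split=> //.
- by move=> x y; rewrite fM MM.
- by rewrite (morph_1 fM).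
Qed.

Lemma rep_kernelT (H : groupType) : rep_kernel Q (fun _ : H => True).
Proof. by exists 1%N, (fun _ => 1%:M); split=> // x y; rewrite mulmx1. Qed.

(** The direct sum of the two representations. *)
Lemma rep_kernelI (H : groupType) (K K' : H -> Prop) :
  rep_kernel Q K -> rep_kernel Q K' -> rep_kernel Q (fun x => K x /\ K' x).
Proof.
move=> [n [M [n0 MM M1 MK]]] [n' [M' [n'0 MM' M1' MK']]].
exists (n + n')%N, (fun x => block_mx (M x) 0 0 (M' x)); split.
- by rewrite addn_gt0 n0.
- by move=> x y; rewrite mulmx_block !mul0mx !mulmx0 !addr0 !add0r MM MM'.
- by rewrite M1 M1' -scalar_mx_block.
move=> x; rewrite scalar_mx_block; split=> [/eq_block_mx[/MK Kx _ _ /MK' K'x]//|].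
by move=> [/MK -> /MK' ->].
Qed.

Lemma rep_kernel_all (H : groupType) (I : eqType) (s : seq I) (K : I -> H -> Prop) :
  (forall i, rep_kernel Q (K i)) -> rep_kernel Q (fun x => forall i, i \in s -> K i x).
Proof.
move=> rK; elim: s => [|i s IH].
  by apply: rep_kernel_eq (@rep_kernelT H) => x; split.
apply: rep_kernel_eq (rep_kernelI (rK i) IH) => x; split=> [[Ki Ks] j|Ks].
  by rewrite inE => /orP[/eqP ->|/Ks].
by split=> [|j js]; apply: Ks; rewrite inE ?eqxx // js orbT.
Qed.

(** The representation is constant on the fibres of [f], so it can be
evaluated on any preimage. *)
Lemma rep_kernel_surj (H H' : groupType) (f : H' -> H) (K : H -> Prop) :
  {morph f : x y / (x * y)%g} -> (forall y, exists x, f x = y) -> K 1%g ->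
  rep_kernel Q (fun x => K (f x)) -> rep_kernel Q K.
Proof.
move=> fM f_surj K1 [n [M [n0 MM M1 MK]]].
pose g y := sval (cid (f_surj y)).
have gK y : f (g y) = y by exact: svalP (cid (f_surj y)).
have MV x : M x *m M x^-1%g = 1%:M by rewrite -MM mulgV.
have M_eq x y : f x = f y -> M x = M y.
  move=> xy; have : M (x * y^-1)%g = 1%:M.
    by apply/MK; rewrite fM (morph_V fM) xy mulgV.
  rewrite MM => E; rewrite -[RHS]mul1mx -E -mulmxA.
  by rewrite -MM mulVg M1 mulmx1.
exists n, (fun y => M (g y)); split=> //.
- by move=> x y; rewrite -MM; apply: M_eq; rewrite fM !gK.
- by rewrite -M1; apply: M_eq; rewrite gK (morph_1 fM).
- by move=> x; rewrite MK gK.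
Qed.

Variable t : Q.
Hypothesis t_free : forall n, (0 < n)%N -> t ^+ n != 1.
Hypothesis t0 : t != 0.

(** The integer [u] acts by the scalar [t ^ u]. *)
Lemma rep_int0 : rep_kernel Q (fun u : GRing.to_multiplicative int => (u : int) = 0).
Proof.
exists 1%N, (fun u : int => (t ^ u)%:M); split=> //.
- by move=> u v; rewrite -scalar_mxM -expfzDr.
- move=> u; split=> [|->]; last by rewrite expr0z.
  move=> /matrixP/(_ 0 0); rewrite !mxE /= !mulr1n.
  case: u => [[|n]|n] //.
    by move=> E; have := t_free (ltn0Sn n); rewrite -exprnP in E; rewrite E eqxx.
  rewrite NegzE -exprnN => /eqP; rewrite invr_eq1 => E.
  by have := t_free (ltn0Sn n); rewrite E.
Qed.

(** The integer [u] acts by a power of the cyclic shift of [d] points. *)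
Lemma rep_int_mod (d : nat) : (0 < d)%N ->
  rep_kernel Q (fun u : GRing.to_multiplicative int => (d%:Z %| (u : int))%Z).
Proof.
case: d => // d _; pose s : 'S_d.+1 := perm (@addIr 'I_d.+1 (inZp 1)).
have sX k (x : 'I_d.+1) : (s ^+ k)%g x = x + inZp k.
  elim: k => [|k IH].
    by rewrite expg0 perm1; apply: val_inj; rewrite /= mod0n addn0 modn_small.
  rewrite expgSr permM IH permE; apply: val_inj => /=.
  rewrite modnDml modnDmr -addnA -[LHS]modnDmr modnDml addn1.
  by rewrite modnDmr.
have sX1 k : ((s ^+ k)%g == 1%g) = (d.+1 %| k)%N.
  apply/eqP/idP => [E|/eqP kd].
    have := sX k ord0; rewrite E perm1 => /(congr1 val) /=.
    by rewrite add0n modn_mod => /esym/eqP.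
  by apply/permP => x; rewrite sX perm1; apply: val_inj; rewrite /= kd addn0 modn_small.
pose r (u : int) : nat := `|(u %% d.+1%:Z)%Z|%N.
have rE u : (r u)%:Z = (u %% d.+1%:Z)%Z by rewrite gez0_abs // modz_ge0.
have sr k l : (k = l %[mod d.+1])%N -> (s ^+ k)%g = (s ^+ l)%g.
  wlog kl : k l / (k <= l)%N.
    by move=> W; have [/W//|/ltnW lk /esym/(W _ _ lk)/esym] := leqP k l.
  move=> /eqP; rewrite eq_sym eqn_mod_dvd // -sX1 => /eqP E.
  by rewrite -(subnK kl) expgD E mul1g.
exists d.+1, (fun u : int => perm_mx (s ^+ r u)%g); split=> //.
- move=> u v; rewrite -perm_mxM -expgD; congr perm_mx; apply: sr.
  apply/eqP; rewrite -eqz_nat -!modz_nat rE PoszD -modzDm !rE !modz_mod.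
  by rewrite modzDm.
- by rewrite (_ : r 0 = 0%N) ?expg0 ?perm_mx1 // /r mod0z.
move=> u; split=> [E|/dvdz_mod0P u0].
  apply/dvdz_mod0P; rewrite -rE; apply/eqP; rewrite eqz_nat -(modn_small (_ : r u < d.+1)%N).
    rewrite -/(dvdn _ _) -sX1; apply/eqP/permP => x; rewrite perm1.
    have := congr1 (fun A : 'M[Q]_d.+1 => A x x) E; rewrite /= !mxE eqxx.
    by case: eqP => // _ /esym/eqP; rewrite oner_eq0.
  by rewrite -ltz_nat rE ltz_pmod.
by rewrite /r u0 expg0 perm_mx1.
Qed.

Lemma rep_int (d : int) :
  rep_kernel Q (fun u : GRing.to_multiplicative int => (d %| (u : int))%Z).
Proof.
have [->|d0] := eqVneq d 0.
  by apply: rep_kernel_eq rep_int0 => u; rewrite dvd0z; split=> [->|/eqP].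
have d_gt0 : (0 < `|d|)%N by rewrite absz_gt0.
by apply: rep_kernel_eq (rep_int_mod d_gt0) => u; rewrite !dvdzE.
Qed.

(** By the Smith normal form, [K] is defined after a change of basis by one
divisibility condition on each coordinate. *)
Lemma rep_lattice n (K : 'rV[int]_n -> Prop) :
  K 0 -> (forall x y, K x -> K y -> K (x - y)) ->
  rep_kernel Q (K : GRing.to_multiplicative 'rV[int]_n -> Prop).
Proof.
move=> K0 KB; have [M ME] := int_lattice K0 KB.
have [L Lu [R Ru [d _ MLR]]] := int_Smith_normal_form M.
pose c (i : 'I_n) (x : GRing.to_multiplicative 'rV[int]_n)
  : GRing.to_multiplicative int := ((x : 'rV[int]_n) *m invmx R) 0 i.
have cM i : {morph c i : x y / (x * y)%g}.
  by move=> x y; rewrite /c [(x * y)%g]/(x + y)%R mulmxDl mxE.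
apply: rep_kernel_eq (rep_kernel_all (enum 'I_n)
  (fun i => rep_kernel_comp (cM i) (rep_int d`_i))) => x.
rewrite ME; split=> [dvd|[y ->] i _]; last first.
  rewrite /c MLR !mulmxA mulmxK // mxE (bigD1 i) //= mxE eqxx mulr1n big1 ?addr0.
    exact: dvdz_mull.
  by move=> j /negPf ji; rewrite mxE val_eqE ji mulr0n mulr0.
have /fin_all_exists[z zE] i : exists z, c i x = z * d`_i.
  by apply/dvdzP/dvd; rewrite mem_enum.
exists ((\row_i z i) *m invmx L); rewrite MLR !mulmxA mulmxKV //.
apply: (canRL (mulmxKV Ru)); apply/rowP => i; rewrite [LHS](zE i).
rewrite mxE (bigD1 i) //= !mxE eqxx mulr1n big1 ?addr0 // => j /negPf ji.
by rewrite !mxE val_eqE ji mulr0n mulr0.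
Qed.

Lemma rep_fg (V : zmodType) (s : seq V) :
  (forall w, exists x, int_comb (s := s) x = w) ->
  rep_kernel Q (fun w : GRing.to_multiplicative V => (w : V) = 0).
Proof.
move=> sV; pose K (x : 'rV[int]_(size s)) := int_comb x = 0 :> V.
have K0 : K 0.
  by rewrite /K /int_comb big1 // => i _; rewrite mxE mulr0z.
have KB x y : K x -> K y -> K (x - y).
  by rewrite /K int_combB => -> ->; rewrite subrr.
pose f (x : GRing.to_multiplicative 'rV[int]_(size s)) : GRing.to_multiplicative V :=
  int_comb (x : 'rV[int]_(size s)).
have fM : {morph f : x y / (x * y)%g} by move=> x y; apply: int_combD.
exact: (rep_kernel_surj fM sV _ (rep_lattice K0 KB)).
Qed.

End Representations.

Lemma rep_kernel_map (P Q : fieldType) (h : {rmorphism P -> Q}) (H : groupType)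
  (K : H -> Prop) : rep_kernel P K -> rep_kernel Q K.
Proof.
move=> [n [M [n0 MM M1 MK]]]; exists n, (fun x => map_mx h (M x)); split=> //.
- by move=> x y; rewrite MM map_mxM.
- by rewrite M1 map_mx1.
- move=> x; rewrite -MK -(map_mx1 h); split=> [|->//].
  exact: map_mx_inj.
Qed.

Lemma linear_rep (H : groupType) : linear_group H ->
  exists P : fieldType, rep_kernel P (fun x : H => x = 1%g).
Proof.
move=> [n [P [f [n0 f_inj]]]]; exists P, n, (fun x => val (f x)).
have fM : {morph f : x y / (x * y)%g} by exact: gmulfM.
have f1 : f 1%g = 1%g := morph_1 fM.
split=> // [x y||x]; rewrite ?fM ?f1 //; split=> [fx|->]; last by rewrite f1.
by apply: f_inj; apply: val_inj; rewrite fx f1.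
Qed.

Lemma rep_linear (P : fieldType) (H : groupType) :
  rep_kernel P (fun x : H => x = 1%g) -> linear_group H.
Proof.
move=> [n [M [n0 MM M1 MK]]].
have Mu x : M x \in unitmx.
  have E : M x *m M x^-1%g = 1%:M by rewrite -MM mulgV.
  by have [] := mulmx1_unit E.
pose f (x : H) : general_linear n P := Sub (M x) (Mu x).
have fM : {morph f : x y / (x * y)%g} by move=> x y; apply: val_inj; apply: MM.
pose ff : {multiplicative H -> general_linear n P} :=
  HB.pack f (isMultiplicative.Build H (general_linear n P) f fM).
exists n, P, ff; split=> // x y /(congr1 val) /= xy.
apply: (mulIg y^-1%g); rewrite mulgV; apply/MK.
by rewrite MM xy -MM mulgV.
Qed.

Lemma linear_iso (H H' : groupType) : isomorphic H H' -> linear_group H' -> linear_group H.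
Proof.
move=> [f [g fK _]] [n [P [h [n0 h_inj]]]]; exists n, P, (h \o f); split=> //.
exact: inj_comp h_inj (can_inj fK).
Qed.

(** The field of [H] is enlarged to rational functions, whose variable has
infinite multiplicative order. *)
Lemma linear_product (V : zmodType) (s : seq V) (H : groupType) :
  (forall w, exists x, int_comb (s := s) x = w) -> linear_group H ->
  linear_group (GRing.to_multiplicative V * H)%type.
Proof.
move=> sV /linear_rep[P rH].
pose Q : fieldType := {fraction {poly P}}.
pose h : {rmorphism P -> Q} := @FracField.tofrac {poly P} \o polyC.
pose t : Q := @FracField.tofrac {poly P} 'X.
have t0 : t != 0 by rewrite tofrac_eq0 polyX_eq0.
have t_free n : (0 < n)%N -> t ^+ n != 1.
  move=> n0; rewrite -tofracXn -tofrac1 tofrac_eq; apply/negP => /eqP.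
  move/(congr1 (fun p : {poly P} => size p)); rewrite size_polyXn size_poly1 => -[n0'].
  by rewrite n0' in n0.
have r1 := rep_kernel_comp (f := fst : (GRing.to_multiplicative V * H)%type -> _)
  (fun x y => erefl) (rep_fg t_free t0 sV).
have r2 := rep_kernel_comp (f := snd : (GRing.to_multiplicative V * H)%type -> _)
  (fun x y => erefl) (rep_kernel_map h rH).
apply: (@rep_linear Q); apply: rep_kernel_eq (rep_kernelI r1 r2) => -[w x] /=.
by split=> [[-> ->]|[-> ->]].
Qed.

(** * The structure of the tensor square *)
Theorem theorem3p3 (G : groupType)
    (H2G : is_trivial (group_homology G 2))
    (H3G : is_trivial (group_homology G 3))
    (H2G' : is_trivial (group_homology (derived G) 2))
    (Hcond :
      [\/ is_trivial (group_cohomology (derived G) (Gamma (abelianization G)) 2),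
          divisible (Gamma (abelianization G))
        | free_abelian (abelianization (derived G))]) :
  isomorphic (tensor_square G)
    (GRing.to_multiplicative (Gamma (abelianization G)) * derived G)%type
  /\ (finitely_generated G -> linear_group (derived G) ->
        linear_group (tensor_square G)).
Proof.
have iso : isomorphic (tensor_square G)
    (GRing.to_multiplicative (Gamma (abelianization G)) * derived G)%type.
  apply: tensor_isomorphic => //; case: Hcond => [H2|div|free].
  - exact: split_of_cohomology.
  - by move=> f fC; apply: split_of_divisible.
  - by move=> f fC; apply: split_of_free.
split=> // fg lin; have [s sP] := Gamma_fg fg.
exact: linear_iso iso (linear_product sP lin).
Qed.
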